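(* (a) The Fourier transform $\mathcal{F}:\mathcal{H}\to\mathcal{H}$ is a linear isomorphism and its inverse is given by $\mathcal{F}^{-1}([f_n])=[\mathcal{F}^{-1}(f_n)]$. (b) Let $[f_n]\in\mathcal{H}$ and $\alpha\in\mathbb{N}_0$. Then $$\mathcal{F}(D^\alpha[f_n])=(ix)^\alpha\mathcal{F}([f_n]),\qquad \mathcal{F}(x^\alpha[f_n])=i^\alpha D^\alpha\mathcal{F}([f_n]).$$ (c) Let $T$ be a tempered distribution. Then $\iota(\mathcal{F}(T))=\mathcal{F}(\iota(T))$.
   Context: $\mathbb{N}_0=\mathbb{N}\cup\{0\}$. $\mathcal{S}$ is the Schwartz space of rapidly decreasing smooth real-valued functions on $\mathbb{R}$, with norms $\|\varphi\|_m=\big(\int_{\mathbb{R}}|(N+1)^m\varphi(x)|^2dx\big)^{1/2}$, $m\in\mathbb{N}_0$, where $N+1=\frac12\big(-\frac{d^2}{dx^2}+x^2+1\big)$; $\mathcal{S}'$ is its dual, the space of tempered distributions. The Hermite functions are $h_n(x)=(\sqrt{2\pi}\,n!)^{-1/2}e^{-x^2/4}H_n(x)$, where $H_n(x)=(-1)^ne^{x^2/2}\frac{d^n}{dx^n}e^{-x^2/2}$, $n\in\mathbb{N}_0$. $\mathbf{s}$ is the space of sequences $(a_n)_{n\in\mathbb{N}_0}\in\ell^2$ with $\sum_n (n+1)^{2m}|a_n|^2<\infty$ for all $m\in\mathbb{N}_0$. $\mathbf{s}'$ is the space of sequences $(b_n)$ for which there are $C\in\mathbb{R}$, $m\in\mathbb{N}_0$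 with $|b_n|\le C(n+1)^m$ for all $n$. $\mathcal{H}_{\mathbf{s}'}$ (resp. $\mathcal{H}_{\mathbf{s}}$) is the set of sequences $(f_n)\in\mathcal{S}^{\mathbb{N}_0}$ such that $(\|f_n\|_m)_n\in\mathbf{s}'$ (resp. $\in\mathbf{s}$) for every $m\in\mathbb{N}_0$. The tempered algebra is $\mathcal{H}=\mathcal{H}_{\mathbf{s}'}/\mathcal{H}_{\mathbf{s}}$ with termwise operations; its elements are called tempered generalized functions. $[f_n]$ is the class of $(f_n)$, $D[f_n]=[Df_n]$ with $D$ the derivative, and for a multiplier $g$ of $\mathcal{S}$ (e.g. a polynomial) $g[f_n]=[gf_n]$. The map $\iota:\mathcal{S}'\to\mathcal{H}$ is the linear embedding $\iota(T)=[T_n]$ with $T_n=\sum_{j=0}^nT(h_j)h_j$. The Fourier transform $\mathcal{F}:\mathcal{S}\to\mathcal{S}$ is $\mathcal{F}(\varphi)(t)=\frac{1}{\sqrt{2\pi}}\int_{\mathbb{R}}e^{-itx}\varphi(x)\,dx$; on tempered distributions it is the usual Fourier transform, $\mathcal{F}(T)(\varphi)=T(\mathcal{F}(\varphi))$. The Fourier transform of a tempered generalized function $[f_n]$ is defined to be $\mathcal{F}([f_n])=[\mathcal{F}(f_n)]$.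
   Formalization: With the printed h_n (weight e^{-x²/4}) part (c) fails, e.g. for T=δ_0; h_n is replaced by its dilation 2^{1/4}h_n(√2 x), the eigenfunction of N+1 and F. As F takes complex values, S and its dual are taken complex-valued. *)

(* Defs.v *)
From HB Require Import structures.
From mathcomp Require Import all_boot all_order all_algebra.
From mathcomp Require Import generic_quotient ring_quotient.
From mathcomp Require Import all_classical all_reals all_analysis.
From mathcomp Require Import complex measurable_realfun lra.

Set Implicit Arguments.
Unset Strict Implicit.
Unset Printing Implicit Defensive.

Import Order.TTheory GRing.Theory Num.Theory.
Import numFieldNormedType.Exports.

Local Open Scope complex_scope.
Local Open Scope ring_scope.
Local Open Scope classical_set_scope.
Local Open Scope quotient_scope.

Local Notation Re := (@complex.Re _).
Local Notation Im := (@complex.Im _).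

Section SchwartzSpace.
Variable R : realType.
Implicit Types (f g : R -> R[i]) (u v : R -> R).

Definition schwartz_real u :=
  (forall n x, derivable (derive1n n u) x 1) /\
  (forall k n, exists C : R, forall x, `|x ^+ k * derive1n n u x| <= C).

(* The Fourier transform takes complex values, so the test functions are the
   complexification of the real Schwartz space. *)
Definition schwartz f :=
  schwartz_real (fun x => Re (f x)) /\ schwartz_real (fun x => Im (f x)).

Definition cderive f : R -> R[i] := fun x =>
  derive1 (fun y => Re (f y)) x +i* derive1 (fun y => Im (f y)) x.

Definition oscillator f : R -> R[i] :=
  2^-1 *: (- cderive (cderive f) + (fun x => (x ^+ 2)%:C * f x) + f).

Definition cabs (z : R[i]) : R := Re `|z|.

Definition snorm (m : nat) f : R :=
  Num.sqrt
    (\int[lebesgue_measure]_x (cabs (iter m oscillator f x) ^+ 2)).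

Definition cintegral f : R[i] :=
  (\int[lebesgue_measure]_x Re (f x)) +i* (\int[lebesgue_measure]_x Im (f x)).

Definition cis (t : R) : R[i] := cos t +i* sin t.

Definition fourier f : R -> R[i] := fun t =>
  (Num.sqrt (2 * pi))^-1%:C * cintegral (fun x => cis (- (t * x)) * f x).

Definition ifourier : (R -> R[i]) -> (R -> R[i]) :=
  'pinv_(fun=> 0) (schwartz : set (R -> R[i])) fourier.

End SchwartzSpace.

Section SchwartzTheory.
Variable R : realType.
Implicit Types (f g : R -> R[i]) (u v : R -> R).

Lemma derive1n_comb (a b : R) u v n :
  schwartz_real u -> schwartz_real v ->
  derive1n n (fun x => a * u x + b * v x) =
  (fun x => a * derive1n n u x + b * derive1n n v x).
Proof.
move=> [du _] [dv _]; elim: n => [//|n IHn].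
rewrite !derive1nS IHn; apply/funext => x; rewrite !derive1E.
have := du n x; have := dv n x.
move: (derive1n n u) (derive1n n v) => u' v' hv hu.
rewrite (_ : (fun x => _) = a *: u' + b *: v'); last by [].
by rewrite deriveD ?deriveZ //; apply: derivableZ.
Qed.

Lemma schwartz_real_comb (a b : R) u v :
  schwartz_real u -> schwartz_real v ->
  schwartz_real (fun x => a * u x + b * v x).
Proof.
move=> hu hv; split=> [n x|k n].
  rewrite derive1n_comb //.
  have := hu.1 n x; have := hv.1 n x.
  move: (derive1n n u) (derive1n n v) => u' v' hv' hu'.
  rewrite (_ : (fun x => _) = a *: u' + b *: v'); last by [].
  by apply: derivableD; apply: derivableZ.
have [C hC] := hu.2 k n; have [D hD] := hv.2 k n.
exists (`|a| * C + `|b| * D) => x; rewrite derive1n_comb //.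
rewrite mulrDr !(mulrCA (x ^+ k)) (le_trans (ler_normD _ _)) //.
by rewrite lerD // normrM ler_wpM2l.
Qed.

Lemma schwartz_real_derive1 u : schwartz_real u -> schwartz_real (derive1 u).
Proof.
move=> [du bu]; split=> [n x|k n]; first by rewrite -derive1Sn.
by have [C hC] := bu k n.+1; exists C => x; rewrite -derive1Sn.
Qed.

Lemma derive1n_mulx u n : schwartz_real u ->
  derive1n n (fun x => x * u x) =
  (fun x => x * derive1n n u x + n%:R * derive1n n.-1 u x).
Proof.
move=> [du _]; elim: n => [|n IHn].
  by apply/funext => x /=; rewrite mul0r addr0.
rewrite derive1nS IHn; apply/funext => x; rewrite derive1E.
have dn m : is_derive x 1 (derive1n m u) (derive1n m.+1 u x).
  by rewrite derive1nS derive1E; apply: derivableP.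
rewrite (_ : (fun x => _) = id * derive1n n u + n%:R *: derive1n n.-1 u);
  last by [].
have h1 := is_deriveM (@is_derive_id _ _ x (1 : R)) (dn n).
have h2 := is_deriveZ n%:R (dn n.-1).
have h3 := is_deriveD h1 h2.
have -> := @derive_val _ _ _ _ _ _ _ h3.
rewrite /GRing.scale /= mulr1 -addrA; congr (_ + _).
case: n {IHn h1 h2 h3} => [|n] /=; first by rewrite mul0r addr0 mul1r.
by rewrite -[LHS]/(derive1n n.+1 u x + n.+1%:R * derive1n n.+1 u x)
  mulr_natl -mulrS mulr_natl.
Qed.

Lemma schwartz_real_mulx u :
  schwartz_real u -> schwartz_real (fun x => x * u x).
Proof.
move=> hu; split=> [n x|k n].
  rewrite derive1n_mulx //.
  have dn m : derivable (derive1n m u) x 1 by apply: hu.1.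
  rewrite (_ : (fun x => _) = id * derive1n n u + n%:R *: derive1n n.-1 u);
    last by [].
  by apply: derivableD; [apply: derivableM|apply: derivableZ].
have [C hC] := hu.2 k.+1 n; have [D hD] := hu.2 k n.-1.
exists (C + n%:R * D) => x; rewrite derive1n_mulx //.
rewrite mulrDr (le_trans (ler_normD _ _)) // lerD //.
  by rewrite mulrA -exprSr.
by rewrite mulrCA normrM normr_nat ler_wpM2l.
Qed.

Lemma derive1_comb (a b : R) u v x :
  schwartz_real u -> schwartz_real v ->
  derive1 (fun x => a * u x + b * v x) x = a * derive1 u x + b * derive1 v x.
Proof. by move=> hu hv; have := derive1n_comb a b 1 hu hv => /= ->. Qed.

Lemma Re_lin (c y z : R[i]) : Re (c * y + z) = Re c * Re y - Im c * Im y + Re z.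
Proof. by case: c y z => [? ?] [? ?] [? ?]. Qed.

Lemma Im_lin (c y z : R[i]) : Im (c * y + z) = Re c * Im y + Im c * Re y + Im z.
Proof. by case: c y z => [? ?] [? ?] [? ?]. Qed.

Lemma schwartz0 : schwartz (0 : R -> R[i]).
Proof.
have h : schwartz_real (fun=> 0 : R).
  have d0 n : derive1n n (fun=> 0 : R) = (fun=> 0 : R).
    elim: n => [//|n IHn]; rewrite derive1nS IHn.
    by apply/funext => x; rewrite derive1_cst.
  split=> [n x|k n]; rewrite d0; first exact: derivable_cst.
  by exists 0 => x; rewrite mulr0 normr0.
by split.
Qed.

Lemma schwartz_lin (c : R[i]) f g :
  schwartz f -> schwartz g -> schwartz (c *: f + g).
Proof.
move=> [rf jf] [rg jg]; split.
  rewrite (_ : (fun x => _) = fun x =>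
    1 * (Re c * Re (f x) + (- Im c) * Im (f x)) + 1 * Re (g x)).
    by apply: schwartz_real_comb => //; apply: schwartz_real_comb.
  by apply/funext => x; rewrite Re_lin !mul1r mulNr.
rewrite (_ : (fun x => _) = fun x =>
  1 * (Re c * Im (f x) + Im c * Re (f x)) + 1 * Im (g x)).
  by apply: schwartz_real_comb => //; apply: schwartz_real_comb.
by apply/funext => x; rewrite Im_lin !mul1r.
Qed.

Lemma schwartz_cderive f : schwartz f -> schwartz (cderive f).
Proof. by move=> [rf jf]; split; apply: schwartz_real_derive1. Qed.

Lemma cderive_lin (c : R[i]) f g : schwartz f -> schwartz g ->
  cderive (c *: f + g) = c *: cderive f + cderive g.
Proof.
move=> [rf jf] [rg jg]; apply/funext => x; rewrite /cderive.
apply/eqP; rewrite eq_complex; apply/andP; split; apply/eqP.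
  rewrite [RHS]Re_lin /=.
  rewrite (_ : (fun x => _) = fun x =>
    1 * (Re c * Re (f x) + (- Im c) * Im (f x)) + 1 * Re (g x)).
    by rewrite !derive1_comb //; [rewrite !mul1r mulNr|apply: schwartz_real_comb].
  by apply/funext => y; rewrite Re_lin !mul1r mulNr.
rewrite [RHS]Im_lin /=.
rewrite (_ : (fun x => _) = fun x =>
  1 * (Re c * Im (f x) + Im c * Re (f x)) + 1 * Im (g x)).
  by rewrite !derive1_comb //; [rewrite !mul1r|apply: schwartz_real_comb].
by apply/funext => y; rewrite Im_lin !mul1r.
Qed.

Lemma schwartz_mulx2 f :
  schwartz f -> schwartz (fun x => (x ^+ 2)%:C * f x).
Proof.
move=> [rf jf]; split.
  rewrite (_ : (fun x => _) = fun x => x * (x * Re (f x))).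
    by do 2!apply: schwartz_real_mulx.
  apply/funext => x; case: (f x) => a b /=.
  by rewrite mul0r subr0 mulrA expr2.
rewrite (_ : (fun x => _) = fun x => x * (x * Im (f x))).
  by do 2!apply: schwartz_real_mulx.
apply/funext => x; case: (f x) => a b /=.
by rewrite mul0r addr0 mulrA expr2.
Qed.

Lemma schwartzD f g : schwartz f -> schwartz g -> schwartz (f + g).
Proof. by move=> hf hg; rewrite -[f]scale1r; apply: schwartz_lin. Qed.

Lemma schwartzZ (c : R[i]) f : schwartz f -> schwartz (c *: f).
Proof.
by move=> hf; rewrite -[_ *: _]addr0; apply: schwartz_lin => //; apply: schwartz0.
Qed.

Lemma schwartzN f : schwartz f -> schwartz (- f).
Proof. by move=> hf; rewrite -scaleN1r; apply: schwartzZ. Qed.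

Lemma schwartz_oscillator f : schwartz f -> schwartz (oscillator f).
Proof.
move=> hf; apply: schwartzZ; apply: schwartzD => //; apply: schwartzD.
  by apply: schwartzN; do 2!apply: schwartz_cderive.
exact: schwartz_mulx2.
Qed.

Lemma oscillator_lin (c : R[i]) f g : schwartz f -> schwartz g ->
  oscillator (c *: f + g) = c *: oscillator f + oscillator g.
Proof.
move=> hf hg; rewrite /oscillator cderive_lin // cderive_lin; last 2 first.
- exact: schwartz_cderive.
- exact: schwartz_cderive.
rewrite scalerA mulrC -scalerA -scalerDr; congr (_ *: _).
rewrite (_ : (fun x : R => _ * (c *: f + g) x) =
  c *: (fun x => (x ^+ 2)%:C * f x) + (fun x => (x ^+ 2)%:C * g x)).
  rewrite !scalerDr scalerN opprD !addrA.
  by rewrite [LHS](AC 6 ((1*3*5)*(2*4*6))) /= !addrA.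
apply/funext => x /=.
by rewrite -[LHS]/(_ * (c * f x + g x)) mulrDr mulrCA.
Qed.

Lemma iter_oscillator m f :
  schwartz f -> schwartz (iter m (@oscillator R) f).
Proof.
by move=> hf; elim: m => [//|m IHm]; rewrite iterS; apply: schwartz_oscillator.
Qed.

Lemma iter_oscillator_lin m (c : R[i]) f g : schwartz f -> schwartz g ->
  iter m (@oscillator R) (c *: f + g) =
  c *: iter m (@oscillator R) f + iter m (@oscillator R) g.
Proof.
move=> hf hg; elim: m => [//|m IHm]; rewrite !iterS IHm oscillator_lin //;
  exact: iter_oscillator.
Qed.

Lemma schwartz_real_continuous u : schwartz_real u -> continuous u.
Proof.
move=> hu x; apply/differentiable_continuous/derivable1_diffP.
exact: (hu.1 0%N x).
Qed.

End SchwartzTheory.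

Section SnormTheory.
Variable R : realType.
Implicit Types (f g : R -> R[i]) (u v : R -> R).

Local Notation mu := (@lebesgue_measure R).

Lemma cabs_ge0 (z : R[i]) : 0 <= cabs z.
Proof. by rewrite /cabs normc_def /= sqrtr_ge0. Qed.

Lemma cabs_sqr (z : R[i]) : cabs z ^+ 2 = Re z ^+ 2 + Im z ^+ 2.
Proof. by rewrite /cabs normc_def /= sqr_sqrtr // addr_ge0 // sqr_ge0. Qed.

Lemma integrable_inv_oneDsqr :
  mu.-integrable setT (EFin \o (fun x : R => (1 + x ^+ 2)^-1)).
Proof.
have p x : 0 <= (1 + x ^+ 2)^-1 :> R by rewrite invr_ge0 addr_ge0 // sqr_ge0.
have c : continuous (fun x : R => (1 + x ^+ 2)^-1) := @continuous_oneDsqrV R.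
apply/integrableP; split.
  by apply/measurable_EFinP; apply: continuous_measurable_fun.
under eq_integral do rewrite gee0_abs ?lee_fin ?p //.
rewrite ge0_symfun_integralT //; last by move=> x /=; rewrite sqrrN.
rewrite -set_itvcy; have := @integral0y_oneDsqr R.
by rewrite /oneDsqr => ->; rewrite -EFinM ltry.
Qed.

Lemma schwartz_real_sqr_integrable u : schwartz_real u ->
  mu.-integrable setT (EFin \o (fun x : R => u x ^+ 2)).
Proof.
move=> hu; have [C0 h0] := hu.2 0%N 0%N; have [C1 h1] := hu.2 1%N 0%N.
set K := C0 ^+ 2 + C1 ^+ 2.
have bd x : u x ^+ 2 <= K * (1 + x ^+ 2)^-1.
  rewrite ler_pdivlMr; last by rewrite ltr_pwDl // sqr_ge0.
  rewrite mulrDr mulr1 lerD //.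
    have := h0 x; rewrite expr0 mul1r => h.
    by rewrite -real_normK ?num_real // lerXn2r ?nnegrE // (le_trans _ h).
  rewrite -exprMn mulrC; have := h1 x; rewrite expr1 => h.
  by rewrite -real_normK ?num_real // lerXn2r ?nnegrE // (le_trans _ h).
have iK := integrableZl measurableT K integrable_inv_oneDsqr.
apply: le_integrable iK => //.
  apply/measurable_EFinP; apply: measurable_funX.
  by apply: continuous_measurable_fun; apply: schwartz_real_continuous.
move=> x _; rewrite /= lee_fin.
rewrite ger0_norm ?sqr_ge0 // (le_trans (bd x)) //.
exact: ler_norm.
Qed.

Lemma schwartz_sqr_integrable f : schwartz f ->
  mu.-integrable setT (EFin \o (fun x => cabs (f x) ^+ 2)).
Proof.
move=> [rf jf]; rewrite (_ : _ \o _ =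
  (EFin \o (fun x => Re (f x) ^+ 2)) \+ (EFin \o (fun x => Im (f x) ^+ 2))).
  by apply: integrableD => //; apply: schwartz_real_sqr_integrable.
by apply/funext => x /=; rewrite cabs_sqr.
Qed.

Lemma snorm_ge0 m f : 0 <= snorm m f.
Proof. exact: sqrtr_ge0. Qed.

Lemma snorm0 m : snorm m (0 : R -> R[i]) = 0.
Proof.
have h0 := @schwartz0 R.
have o0 : iter m (@oscillator R) 0 = 0.
  have := iter_oscillator_lin m (-1) h0 h0.
  by rewrite scaler0 addr0 scaleN1r addNr.
rewrite /snorm o0 (_ : (fun x => _) = fun=> 0); last first.
  by apply/funext => x; rewrite cabs_sqr /= expr0n /= addr0.
by rewrite Rintegral_cst // mul0r sqrtr0.
Qed.

Lemma snormZ m (c : R[i]) f : schwartz f ->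
  snorm m (c *: f) = cabs c * snorm m f.
Proof.
move=> hf; rewrite /snorm -[c *: f]addr0.
rewrite iter_oscillator_lin //; last exact: schwartz0.
have -> : iter m (@oscillator R) 0 = 0.
  have h0 := @schwartz0 R.
  have := iter_oscillator_lin m (-1) h0 h0.
  by rewrite scaler0 addr0 scaleN1r addNr.
rewrite addr0 (_ : (fun x => _) = fun x =>
  cabs c ^+ 2 * cabs (iter m (@oscillator R) f x) ^+ 2); last first.
  apply/funext => x; rewrite -exprMn; congr (_ ^+ 2).
  rewrite -[LHS]/(Re `|c * iter m (@oscillator R) f x|) normrM /cabs !normc_def.
  by rewrite -rmorphM.
rewrite RintegralZl //; last first.
  exact/schwartz_sqr_integrable/iter_oscillator.
by rewrite sqrtrM ?sqr_ge0 // sqrtr_sqr ger0_norm ?cabs_ge0.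
Qed.

Lemma snormD m f g : schwartz f -> schwartz g ->
  snorm m (f + g) <= 2 * (snorm m f + snorm m g).
Proof.
move=> hf hg; rewrite /snorm -[f in f + g]scale1r iter_oscillator_lin // scale1r.
have ha := iter_oscillator m hf; have hb := iter_oscillator m hg.
move: (iter m _ f) (iter m _ g) ha hb => a b ha hb {hf hg}.
have ia := schwartz_sqr_integrable ha; have ib := schwartz_sqr_integrable hb.
set A := (\int[mu]_x (cabs (a x) ^+ 2)).
set B := (\int[mu]_x (cabs (b x) ^+ 2)).
have A0 : 0 <= A by apply: Rintegral_ge0 => x _; apply: sqr_ge0.
have B0 : 0 <= B by apply: Rintegral_ge0 => x _; apply: sqr_ge0.
have h : \int[mu]_x (cabs ((a + b) x) ^+ 2) <= 4 * (A + B).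
  rewrite /A /B -RintegralD // -RintegralZl //; last first.
    by rewrite (_ : _ \o _ = (EFin \o (fun x => cabs (a x) ^+ 2)) \+
       (EFin \o (fun x => cabs (b x) ^+ 2))) //; apply: integrableD.
  apply: le_Rintegral => //.
  - rewrite -[a]scale1r; apply: schwartz_sqr_integrable.
    exact: schwartz_lin.
  - apply: (@integrableZl _ _ _ mu _ measurableT 4
      (EFin \o (fun x => cabs (a x) ^+ 2 + cabs (b x) ^+ 2))).
    by rewrite (_ : _ \o _ = (EFin \o (fun x => cabs (a x) ^+ 2)) \+
       (EFin \o (fun x => cabs (b x) ^+ 2))) //; apply: integrableD.
  move=> x _; rewrite !cabs_sqr -[(a + b) x]/(a x + b x).
  case: (a x) (b x) => [p q] [r s] /=.
  have e p' r' : (p' + r') ^+ 2 <= 4 * (p' ^+ 2 + r' ^+ 2) :> R.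
    have h1 := sqr_ge0 (p' - r'); have h2 := sqr_ge0 p'; have h3 := sqr_ge0 r'.
    by lra.
  by rewrite addrACA mulrDr lerD.
rewrite (le_trans (ler_wsqrtr h)) //.
rewrite -[leRHS]ger0_norm ?mulr_ge0 ?addr_ge0 ?sqrtr_ge0 // -sqrtr_sqr.
apply: ler_wsqrtr; rewrite exprMn -natrX ler_pM2l // sqrrD.
rewrite !sqr_sqrtr // lerD2r lerDl mulrn_wge0 // mulr_ge0 // sqrtr_ge0.
Qed.

End SnormTheory.

Section TemperedSequences.
Variable R : realType.

Definition rapidly_decreasing (a : nat -> R) :=
  forall m : nat, cvgn (series (fun n => n.+1%:R ^+ (2 * m) * `|a n| ^+ 2)).

Definition slowly_increasing (b : nat -> R) :=
  exists (C : R) (m : nat), forall n, `|b n| <= C * n.+1%:R ^+ m.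

Definition moderate (f : nat -> R -> R[i]) :=
  (forall n, schwartz (f n)) /\
  (forall m, slowly_increasing (fun n => snorm m (f n))).

Definition negligible (f : nat -> R -> R[i]) :=
  (forall n, schwartz (f n)) /\
  (forall m, rapidly_decreasing (fun n => snorm m (f n))).

Lemma slowly_increasing_le (K : R) a b c :
  slowly_increasing a -> slowly_increasing b ->
  (forall n, `|c n| <= K * (`|a n| + `|b n|)) -> slowly_increasing c.
Proof.
move=> [C [m hC]] [D [p hD]] h.
have e1 n q r : n.+1%:R ^+ q <= n.+1%:R ^+ (q + r) :> R.
  by rewrite ler_weXn2l ?leq_addr // ler1n.
exists (`|K| * (`|C| + `|D|)), (m + p)%N => n.
rewrite (le_trans (h n)) // -mulrA.
have s0 : 0 <= `|a n| + `|b n| by rewrite addr_ge0.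
apply: (le_trans (ler_wpM2r s0 (ler_norm K))).
apply: ler_wpM2l => //; rewrite mulrDl lerD //.
  apply: (le_trans (hC n)); apply: (@le_trans _ _ (`|C| * n.+1%:R ^+ m)).
    by apply: ler_wpM2r; rewrite ?exprn_ge0 // ler_norm.
  exact: ler_wpM2l.
apply: (le_trans (hD n)).
apply: (@le_trans _ _ (`|D| * n.+1%:R ^+ p)).
  by apply: ler_wpM2r; rewrite ?exprn_ge0 // ler_norm.
by apply: ler_wpM2l => //; rewrite addnC e1.
Qed.

Lemma rapidly_decreasing_le (K : R) a b c :
  rapidly_decreasing a -> rapidly_decreasing b ->
  (forall n, `|c n| <= K * (`|a n| + `|b n|)) -> rapidly_decreasing c.
Proof.
move=> ha hb h m; have ca := ha m; have cb := hb m.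
pose w n : R := n.+1%:R ^+ (2 * m).
have w0 n : 0 <= w n by rewrite exprn_ge0.
have cab := is_cvg_seriesD ca cb.
have cKab := @is_cvg_seriesZ _ _ (2 * K ^+ 2) cab.
apply: (series_le_cvg _ _ _ cKab) => n.
- by rewrite mulr_ge0 ?sqr_ge0.
- apply: mulr_ge0; first by rewrite mulr_ge0 ?sqr_ge0.
  by apply: addr_ge0; rewrite mulr_ge0 ?sqr_ge0.
rewrite -[leRHS]/(2 * K ^+ 2 * (w n * `|a n| ^+ 2 + w n * `|b n| ^+ 2)).
rewrite -mulrDr [leRHS]mulrCA -[leLHS]/(w n * `|c n| ^+ 2); apply: ler_wpM2l => //.
apply: (@le_trans _ _ ((K * (`|a n| + `|b n|)) ^+ 2)).
  by rewrite lerXn2r ?nnegrE // (le_trans _ (h n)).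
rewrite exprMn [leRHS]mulrAC [leRHS]mulrC; apply: ler_wpM2l; first exact: sqr_ge0.
have := sqr_ge0 (`|a n| - `|b n|); lra.
Qed.

Lemma moderate_lin (c : R[i]) f g :
  moderate f -> moderate g -> moderate (c *: f + g).
Proof.
move=> [sf mf] [sg mg]; split=> [n|m]; first exact: schwartz_lin.
apply: (@slowly_increasing_le (2 * (cabs c + 1)) _ _ _ (mf m) (mg m)) => n.
rewrite !ger0_norm ?snorm_ge0 //.
apply: (le_trans (snormD m (schwartzZ c (sf n)) (sg n))).
rewrite snormZ // -mulrA ler_pM2l //.
have := snorm_ge0 m (f n); have := snorm_ge0 m (g n); have := cabs_ge0 c.
move: (cabs c) (snorm m (f n)) (snorm m (g n)) => x y z; nra.
Qed.

Lemma negligible_lin (c : R[i]) f g :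
  negligible f -> negligible g -> negligible (c *: f + g).
Proof.
move=> [sf mf] [sg mg]; split=> [n|m]; first exact: schwartz_lin.
apply: (@rapidly_decreasing_le (2 * (cabs c + 1)) _ _ _ (mf m) (mg m)) => n.
rewrite !ger0_norm ?snorm_ge0 //.
apply: (le_trans (snormD m (schwartzZ c (sf n)) (sg n))).
rewrite snormZ // -mulrA ler_pM2l //.
have := snorm_ge0 m (f n); have := snorm_ge0 m (g n); have := cabs_ge0 c.
move: (cabs c) (snorm m (f n)) (snorm m (g n)) => x y z; nra.
Qed.

Lemma moderate0 : moderate 0.
Proof.
split=> [n|m]; first exact: schwartz0.
by exists 0, 0%N => n; rewrite snorm0 normr0 mul0r.
Qed.

Lemma negligible0 : negligible 0.
Proof.
split=> [n|m p]; first exact: schwartz0.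
rewrite (_ : (fun n => _) = fun=> 0).
  rewrite (_ : series _ = cst 0); first exact: is_cvg_cst.
  by apply/funext => n; rewrite /series /= big1.
by apply/funext => n; rewrite snorm0 normr0 expr0n mulr0.
Qed.

Definition moderate_pred : {pred nat -> R -> R[i]} := fun f => `[< moderate f >].

Lemma moderate_submod_closed : submod_closed moderate_pred.
Proof.
split=> [|c f g /asboolP hf /asboolP hg]; apply/asboolP.
  exact: moderate0.
exact: moderate_lin.
Qed.

HB.instance Definition _ := GRing.isSubmodClosed.Build R[i] (nat -> R -> R[i])
  moderate_pred moderate_submod_closed.

Record moderate_seq := ModerateSeq {
  moderate_val :> nat -> R -> R[i];
  _ : moderate_val \in moderate_pred }.

HB.instance Definition _ := [isSub for moderate_val].
HB.instance Definition _ := [Choice of moderate_seq by <:].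
HB.instance Definition _ := [SubChoice_isSubLmodule of moderate_seq by <:].

Lemma moderate_valD (f g : moderate_seq) :
  moderate_val (f + g) = moderate_val f + moderate_val g.
Proof. by []. Qed.

Lemma moderate_valZ (c : R[i]) (f : moderate_seq) :
  moderate_val (c *: f) = c *: moderate_val f.
Proof. by []. Qed.

Definition negligible_pred : {pred moderate_seq} := fun f => `[< negligible f >].

Lemma negligible_submod_closed : submod_closed negligible_pred.
Proof.
split=> [|c f g /asboolP hf /asboolP hg]; apply/asboolP.
  exact: negligible0.
rewrite moderate_valD moderate_valZ; exact: negligible_lin.
Qed.

HB.instance Definition _ := GRing.isSubmodClosed.Build R[i] moderate_seq
  negligible_pred negligible_submod_closed.

(* Negligible sequences are moderate, so this is the quotient of the moderate
   sequences by all the negligible ones. *)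
Definition tempered_gf := Quotient.quot negligible_pred.

HB.instance Definition _ := Choice.on tempered_gf.
HB.instance Definition _ := GRing.Zmodule.on tempered_gf.
HB.instance Definition _ := EqQuotient.on tempered_gf.

End TemperedSequences.

Section TemperedAlgebra.
Variable R : realType.
Local Notation H := (tempered_gf R).
Implicit Types X Y : H.

Definition gf_scale (c : R[i]) X : H := \pi_H (c *: repr X).

Lemma gf_piZ (c : R[i]) (f : moderate_seq R) :
  gf_scale c (\pi_H f) = \pi_H (c *: f).
Proof.
apply/eqP; rewrite /gf_scale -Quotient.idealrBE -scalerBr.
apply: rpredZ; rewrite Quotient.idealrBE; apply/eqP; exact: reprK.
Qed.

Lemma gf_scalerA (a b : R[i]) X :
  gf_scale a (gf_scale b X) = gf_scale (a * b) X.
Proof. by elim/quotW: X => f; rewrite (gf_piZ b) !gf_piZ scalerA. Qed.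

Lemma gf_scale1r : left_id 1 gf_scale.
Proof. by elim/quotW=> f; rewrite gf_piZ scale1r. Qed.

Lemma gf_piD (f g : moderate_seq R) : \pi_H (f + g) = \pi_H f + \pi_H g.
Proof. exact: raddfD. Qed.

Lemma gf_scalerDr : right_distributive gf_scale +%R.
Proof.
move=> c; elim/quotW=> f; elim/quotW=> g.
by rewrite -gf_piD !gf_piZ scalerDr gf_piD.
Qed.

Lemma gf_scalerDl X : {morph gf_scale^~ X : a b / a + b}.
Proof. by elim/quotW: X => f a b; rewrite !gf_piZ scalerDl gf_piD. Qed.

HB.instance Definition _ := GRing.Zmodule_isLmodule.Build R[i] H
  gf_scalerA gf_scale1r gf_scalerDr gf_scalerDl.

(* [gf_class f] is the class of [f]; it is only meaningful for moderate [f]. *)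
Definition gf_class (f : nat -> R -> R[i]) : H :=
  \pi_H (insubd (0 : moderate_seq R) f).

Definition termwise (Phi : (R -> R[i]) -> (R -> R[i])) X : H :=
  gf_class (fun n => Phi (repr X n)).

(* Under this property the default value of [gf_class] and the choice of the
   representative in [termwise] are irrelevant. *)
Definition acts_termwise (Phi : (R -> R[i]) -> (R -> R[i])) :=
  forall f, moderate f ->
    moderate (fun n => Phi (f n)) /\
    termwise Phi (gf_class f) = gf_class (fun n => Phi (f n)).

Definition fourier_gf : H -> H := termwise (@fourier R).

Definition ifourier_gf : H -> H := termwise (@ifourier R).

Definition deriv_gf : H -> H := termwise (@cderive R).

Definition fmul (g f : R -> R[i]) : R -> R[i] := fun x => g x * f x.

Definition mul_gf (g : R -> R[i]) : H -> H := termwise (fmul g).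

End TemperedAlgebra.

Section Distributions.
Variable R : realType.
Implicit Type T : (R -> R[i]) -> R[i].

(* Only the values of [T] on Schwartz functions matter; continuity is for the
   topology defined by the family of norms [snorm m]. *)
Definition tempered_distribution T :=
  (forall (c : R[i]) phi psi, schwartz phi -> schwartz psi ->
     T (c *: phi + psi) = c * T phi + T psi) /\
  (forall phi, schwartz phi -> forall e : R, 0 < e ->
     exists (M : nat) (d : R), 0 < d /\
       forall psi, schwartz psi ->
         (forall m, (m <= M)%N -> snorm m (psi - phi) < d) ->
         cabs (T psi - T phi) < e).

Definition fourier_dist T : (R -> R[i]) -> R[i] := fun phi => T (fourier phi).

Definition hermite_poly (n : nat) (x : R) : R :=
  (-1) ^+ n * expR (x ^+ 2 / 2) * derive1n n (fun y => expR (- (y ^+ 2 / 2))) x.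

Definition hermite_quarter (n : nat) (x : R) : R :=
  (Num.sqrt (Num.sqrt (2 * pi) * n`!%:R))^-1 * expR (- (x ^+ 2 / 4)) *
  hermite_poly n x.

(* [hermite_quarter n], with weight exp (- x^2 / 4), is an eigenfunction of
   - d^2/dx^2 + x^2 / 4.  The eigenfunction of [oscillator] (eigenvalue n + 1)
   and of [fourier] (eigenvalue (- 'i)^n) is its unitary dilation by sqrt 2,
   i.e. (sqrt pi 2^n n!)^(-1/2) exp (- x^2 / 2) times the physicists' Hermite
   polynomial; for the undilated functions the embedding below would not
   commute with the Fourier transform. *)
Definition hermite_fun (n : nat) : R -> R[i] := fun x =>
  (Num.sqrt (Num.sqrt 2) * hermite_quarter n (Num.sqrt 2 * x))%:C.

Definition hermite_sum T (n : nat) : R -> R[i] :=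
  \sum_(j < n.+1) T (hermite_fun j) *: hermite_fun j.

Definition iota_dist T : tempered_gf R := gf_class (hermite_sum T).

End Distributions.

(* Main.v *)
Require Import Defs.
From HB Require Import structures.
From mathcomp Require Import all_boot all_order all_algebra.
From mathcomp Require Import generic_quotient ring_quotient.
From mathcomp Require Import all_classical all_reals all_analysis.
From mathcomp Require Import complex measurable_realfun ring lra.

Set Implicit Arguments.
Unset Strict Implicit.
Unset Printing Implicit Defensive.

Import Order.TTheory GRing.Theory Num.Theory.
Import numFieldNormedType.Exports.

Local Open Scope complex_scope.
Local Open Scope ring_scope.
Local Open Scope classical_set_scope.

(** Why the theorem holds.

    On the Schwartz space the Fourier transform [F] exchanges derivation and
    multiplication by the variable: [F D = i x F] and [F x = i D F]
    ([fourier_cderive], [fourier_mulx]).  Everything else is extracted from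
    these two relations.

    Inversion.  To see that [F (F f)] is the reflection of [f] at a point [s],
    subtract a multiple of the Gaussian, which [F] fixes, so that [f s = 0].
    Then [f = (x - s) g] with [g] again a Schwartz function
    ([schwartz_division]), and since [F F] anticommutes with multiplication by
    [x], the function [F (F f)] vanishes at [- s].  Hence [F] has order four: it
    is a bijection of the Schwartz space whose inverse is [F F F].

    Continuity.  [F] commutes with the oscillator [N + 1], so the norm of order
    [m] of [F f] is the L2 norm of the transform of [(N + 1)^m f], and only
    that L2 norm has to be estimated.  It is controlled by the L1 norms of [f]
    and [D f], these by weighted L2 norms, and the latter by the energy identity
      |D u|^2 + |x u|^2 + |u|^2 = 2 <u, (N + 1) u>        ([energy_identity]).
    The same identity, with the commutators of [N + 1] with [D] and [x], bounds
    [D] and [x] for all the norms.  A linear operator with such bounds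
    ([tempered_operator]) preserves moderate and negligible sequences, hence
    acts on their quotient ([tempered_operator_acts]); the statements about
    generalized functions are then identities between operators on the
    Schwartz space, read term by term.

    Embedding of distributions.  The Hermite functions arise from the Gaussian
    by iterating the creation operator [x - D], which [F] multiplies by [- i]
    and which raises eigenvalues of [N + 1] by one.  So [(N + 1) h_n =
    (n + 1) h_n] and [F h_n = (- i)^n h_n], whence
    [T (F h_j) h_j = F (T (h_j) h_j)]: the representatives of both sides
    coincide term by term ([hermite_sum_fourier]).  They are moderate because
    the continuity of [T] at 0 makes [T (h_j)] grow polynomially. *)

(** * Integrals over the real line *)
Section IntegralsOnTheLine.
Variable R : realType.
Implicit Types (u v w : R -> R) (a b t x : R).
Local Notation mu := (@lebesgue_measure R).

(** The weight (1 + x^2)^-1 serves both as an integrable majorant and as a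
    function vanishing at infinity, so one decay condition covers the
    integrability of [w'] and the boundary terms of [w] below. *)
Definition dominated u := exists C : R, forall x, `|u x| <= C * (1 + x ^+ 2)^-1.

Lemma oneDsqr_gt0 x : 0 < 1 + x ^+ 2.
Proof. by rewrite ltr_pwDl // sqr_ge0. Qed.

Lemma dominated_integrable u :
  continuous u -> dominated u -> mu.-integrable setT (EFin \o u).
Proof.
move=> cu [C hC].
have iK := integrableZl measurableT C (@integrable_inv_oneDsqr R).
apply: le_integrable iK => //.
  by apply/measurable_EFinP; apply: continuous_measurable_fun.
move=> x _; rewrite /= lee_fin (le_trans (hC x)) //; exact: ler_norm.
Qed.

Lemma dominatedM u v C : (forall x, `|u x| <= C) -> dominated v ->
  dominated (fun x => u x * v x).
Proof.
move=> hu [D hD]; exists (C * D) => x.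
by rewrite normrM -mulrA ler_pM.
Qed.

(** The fundamental theorem of calculus on [-n, n] gives [w n - w (- n)], which
    tends to 0 by decay, while the integrals over [-n, n] tend to the integral
    over the line by dominated convergence.  All integrations by parts below
    are instances of this lemma. *)
Lemma Rintegral_derive_eq0 w w' :
  (forall x, is_derive x 1 w (w' x)) -> continuous w' ->
  dominated w -> dominated w' -> \int[mu]_x w' x = 0.
Proof.
move=> dw cw' [C hC] [C' hC'].
have iw' : mu.-integrable setT (EFin \o w').
  by apply: dominated_integrable => //; exists C'.
have cw : continuous w.
  move=> x; apply/differentiable_continuous/derivable1_diffP.
  by have := dw x => -[].
pose f_ n x : \bar R := ((w' \_ (`[- n.+1%:R, n.+1%:R]%classic)) x)%:E.
have intn n : (\int[mu]_x (f_ n x) = (w n.+1%:R - w (- n.+1%:R))%:E)%E.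
  have -> : f_ n = (EFin \o w') \_ `[- n.+1%:R, n.+1%:R]%classic.
    by rewrite restrict_EFin.
  rewrite -integral_mkcond.
  have lt : - n.+1%:R < n.+1%:R :> R by rewrite gtrN.
  rewrite (@continuous_FTC2 _ w' w) //.
  - by apply: continuous_subspaceT.
  - split => [x _||].
    + by have := dw x => -[].
    + by apply: cvg_at_right_filter; apply: cw.
    + by apply: cvg_at_left_filter; apply: cw.
  - by move=> x _; rewrite derive1E; apply: derive_val.
have iE : (\int[mu]_x (w' x)%:E = (\int[mu]_x w' x)%:E)%E.
  by rewrite /Rintegral fineK //; apply: integrable_fin_num.
have cv1 : (\int[mu]_x f_ n x @[n --> \oo] --> \int[mu]_x (w' x)%:E)%E.
  apply: (@dominated_cvg _ _ _ mu _ _ f_ _ (fun x => `|(w' x)%:E|%E)) => //.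
  - move=> n; apply/measurable_EFinP.
    apply/(measurable_restrictT w' (measurable_itv _)).
    by apply: measurable_funS (continuous_measurable_fun cw').
  - move=> x _; apply: cvg_near_cst; near=> n.
    rewrite /f_ patchE mem_set //= in_itv /= -ler_norml.
    near: n; exists (Num.truncn `|x|) => // n /= hn.
    by apply: ltW; apply: (lt_le_trans (truncnS_gt _)); rewrite ler_nat ltnS.
  - exact: integrable_abse.
  - move=> n x _; rewrite /f_ patchE; case: ifP => //= _.
    by rewrite normr0 lee_fin.
have cv2 : (\int[mu]_x f_ n x @[n --> \oo] --> 0%E)%E.
  under eq_fun do rewrite intn.
  apply: cvg_EFin; first exact: nearW.
  have C0 : 0 <= C by have := le_trans (normr_ge0 _) (hC 0); rewrite expr0n addr0 invr1 mulr1.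
  have b n y : `|y| = n.+1%:R -> `|w y| <= C * n.+1%:R^-1.
    move=> hy; apply: (le_trans (hC y)); apply: ler_wpM2l => //.
    rewrite -[y ^+ 2]real_normK ?num_real // hy lef_pV2 ?posrE ?oneDsqr_gt0 //.
    have : 1 <= n.+1%:R :> R by rewrite ler1n.
    by move: (n.+1%:R : R) => z hz; nra.
  apply: norm_cvg0.
  apply: (@squeeze_cvgr _ _ _ _ (cst 0) (fun n => (2 * C) * n.+1%:R^-1)).
  - apply: nearW => n; rewrite normr_ge0 /=.
    apply: (le_trans (ler_normB _ _)).
    have := lerD (b n n.+1%:R (ger0_norm (ler0n _ _)))
      (b n (- n.+1%:R) (etrans (normrN _) (ger0_norm (ler0n _ _)))).
    by rewrite -mulrA mulr_natl mulr2n.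
  - exact: cvg_cst.
  - rewrite -[X in _ --> X](mulr0 (2 * C)); apply: cvgMr.
    exact: cvg_harmonic.
have : (\int[mu]_x (w' x)%:E)%E = 0%E by exact: cvg_unique cv1 cv2.
by rewrite iE => -[].
Unshelve. all: end_near. Qed.

Lemma schwartz_is_derive u x : schwartz_real u -> is_derive x 1 u (derive1 u x).
Proof. by move=> hu; rewrite derive1E; apply/derivableP/(hu.1 0%N). Qed.

Lemma schwartz_bounded u :
  schwartz_real u -> exists2 C : R, 0 <= C & forall x, `|u x| <= C.
Proof.
move=> hu; have [C hC] := hu.2 0%N 0%N; exists C => [|x].
  exact: le_trans (hC 0).
by have := hC x; rewrite expr0 mul1r.
Qed.

Lemma schwartz_dominated u : schwartz_real u -> dominated u.
Proof.
move=> hu; have [C hC] := hu.2 0%N 0%N; have [D hD] := hu.2 2%N 0%N.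
exists (C + D) => x; rewrite ler_pdivlMr ?oneDsqr_gt0 //.
rewrite mulrDr mulr1 lerD //; first by have := hC x; rewrite expr0 mul1r.
by have := hD x; rewrite normrM (ger0_norm (sqr_ge0 x)) mulrC.
Qed.

Lemma schwartz_integrable u :
  schwartz_real u -> mu.-integrable setT (EFin \o u).
Proof.
move=> hu; apply: dominated_integrable; last exact: schwartz_dominated.
exact: schwartz_real_continuous.
Qed.

Definition normL1 u := \int[mu]_x `|u x|.

Lemma integrable_scale a u : mu.-integrable setT (EFin \o u) ->
  mu.-integrable setT (EFin \o (fun x => a * u x)).
Proof. exact: (@integrableZl _ _ _ mu _ measurableT a (EFin \o u)). Qed.

Lemma integrable_combl a b u v :
  mu.-integrable setT (EFin \o u) -> mu.-integrable setT (EFin \o v) ->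
  mu.-integrable setT (EFin \o (fun x => a * u x + b * v x)).
Proof.
move=> iu iv; apply: (@integrableD _ _ _ mu _ measurableT
  (EFin \o (fun x => a * u x)) (EFin \o (fun x => b * v x)));
  exact: integrable_scale.
Qed.

Lemma Rintegral_combl a b u v :
  mu.-integrable setT (EFin \o u) -> mu.-integrable setT (EFin \o v) ->
  \int[mu]_x (a * u x + b * v x) = a * \int[mu]_x u x + b * \int[mu]_x v x.
Proof.
move=> iu iv; rewrite -!RintegralZl // -RintegralD //; exact: integrable_scale.
Qed.

End IntegralsOnTheLine.

(** * Cosine and sine transforms of real Schwartz functions *)
Section TrigTransform.
Variable R : realType.
Implicit Types (u v w : R -> R) (a b t x : R).
Local Notation mu := (@lebesgue_measure R).

(** Differentiation sends the pair of coefficients [(a, b)] to [(b, - a)], so the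
    span of cosine and sine is closed under it and both transforms can be
    treated by a single induction. *)
Definition trig a b x : R := a * cos x + b * sin x.

Lemma trig_is_derive a b x : is_derive x 1 (trig a b) (trig b (- a) x).
Proof.
have h := is_deriveD (is_deriveZ a (is_derive_cos x))
  (is_deriveZ b (is_derive_sin x)).
apply: (is_derive_eq h); rewrite /trig /GRing.scale /=; ring.
Qed.

Lemma trig_continuous a b : continuous (trig a b).
Proof.
move=> x; apply/differentiable_continuous/derivable1_diffP.
by have [] := trig_is_derive a b x.
Qed.

Lemma trig_le a b x : `|trig a b x| <= `|a| + `|b|.
Proof.
rewrite (le_trans (ler_normD _ _)) // !normrM lerD // ler_piMr //.
  by rewrite ler_norml cos_geN1 cos_le1.
by rewrite ler_norml sin_geN1 sin_le1.
Qed.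

Definition trig_transform a b u t := \int[mu]_x (trig a b (t * x) * u x).

Lemma trig_dil_continuous a b t : continuous (fun x => trig a b (t * x)).
Proof.
move=> x; apply: (@continuous_comp _ _ _ ( *%R t) (trig a b)).
  exact: mulrl_continuous.
exact: trig_continuous.
Qed.

Lemma trig_schwartz_continuous a b u t : schwartz_real u ->
  continuous (fun x => trig a b (t * x) * u x).
Proof.
move=> hu x; apply: cvgM; first exact: trig_dil_continuous.
exact: schwartz_real_continuous.
Qed.

Lemma trig_schwartz_dominated a b u t : schwartz_real u ->
  dominated (fun x => trig a b (t * x) * u x).
Proof.
move=> hu; apply: dominatedM (schwartz_dominated hu).
by move=> x; apply: trig_le.
Qed.

Lemma trig_schwartz_integrable a b u t : schwartz_real u ->
  mu.-integrable setT (EFin \o (fun x => trig a b (t * x) * u x)).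
Proof.
move=> hu; apply: dominated_integrable.
  exact: trig_schwartz_continuous.
exact: trig_schwartz_dominated.
Qed.

Lemma trig_transform_le a b u t : schwartz_real u ->
  `|trig_transform a b u t| <= (`|a| + `|b|) * normL1 u.
Proof.
move=> hu; have iu := schwartz_integrable hu.
apply: (le_trans (le_normr_Rintegral measurableT (trig_schwartz_integrable a b t hu))).
rewrite -RintegralZl //; last exact: integrable_norm.
apply: le_Rintegral => //.
- by apply: integrable_norm => //; apply: trig_schwartz_integrable.
- exact/integrable_scale/integrable_norm.
- by move=> x _; rewrite normrM ler_wpM2r // trig_le.
Qed.

(** Differentiation under the integral sign; the derivative of the integrand is
    dominated, uniformly in [t], by a multiple of [|x u x|]. *)
Lemma trig_transform_is_derive a b u t : schwartz_real u ->
  is_derive t 1 (trig_transform a b u)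
    (trig_transform b (- a) (fun x => x * u x) t).
Proof.
move=> hu; have hxu := schwartz_real_mulx hu.
pose f t x := trig a b (t * x) * u x.
have df (s x : R) : is_derive s (1 : R) (f^~ x) (trig b (- a) (s * x) * (x * u x)).
  have h1 := is_deriveM (@is_derive_id _ _ s (1 : R)) (is_derive_cst x s (1 : R)).
  have h2 := @is_derive1_comp _ (trig a b) (id * cst x) s _ _
    (trig_is_derive a b (s * x)) h1.
  apply: (is_derive_eq (is_deriveM h2 (is_derive_cst (u x) s (1 : R)))).
  rewrite /trig /GRing.scale /=. ring.
have pE s x : partial1of2 f s x = trig b (- a) (s * x) * (x * u x).
  by rewrite partial1of2E; apply: derive_val.
have It : `]t - 1, t + 1[%classic t by rewrite /= in_itv /= ltrBlDr !ltrDl ltr01.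
pose G x := (`|b| + `|a|) * `|x * u x|.
have G0 x : 0 <= G x by rewrite mulr_ge0.
have iG : mu.-integrable setT (EFin \o G).
  exact/integrable_scale/integrable_norm/schwartz_integrable.
have if_ s : `]t - 1, t + 1[%classic s -> mu.-integrable setT (EFin \o f s).
  by move=> _; apply: trig_schwartz_integrable.
have df1 s x : `]t - 1, t + 1[%classic s -> setT x -> derivable (f^~ x) s 1.
  by move=> _ _; have [] := df s x.
have Gub s x : `]t - 1, t + 1[%classic s -> setT x -> `|partial1of2 f s x| <= G x.
  by move=> _ _; rewrite pE normrM ler_wpM2r // -(normrN a) trig_le.
have dF := derivable_under_integral measurableT It if_ df1 G0 iG Gub.
have := differentiation_under_integral measurableT It if_ df1 G0 iG Gub.
rewrite derive1E => e; apply: DeriveDef => //; rewrite [LHS]e.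
by apply: eq_Rintegral => x _; rewrite pE.
Qed.

Lemma trig_transform_comb a b c d u v t :
  schwartz_real u -> schwartz_real v ->
  trig_transform a b (fun x => c * u x + d * v x) t =
  c * trig_transform a b u t + d * trig_transform a b v t.
Proof.
move=> hu hv; rewrite -Rintegral_combl; try exact: trig_schwartz_integrable.
by apply: eq_Rintegral => x _; ring.
Qed.

Lemma trig_transform_coef a b c d k l u t : schwartz_real u ->
  k * trig_transform a b u t + l * trig_transform c d u t =
  trig_transform (k * a + l * c) (k * b + l * d) u t.
Proof.
move=> hu; rewrite -Rintegral_combl; try exact: trig_schwartz_integrable.
by apply: eq_Rintegral => x _; rewrite /trig; ring.
Qed.

(** Integration by parts; the boundary terms vanish because [u] decays. *)
Lemma trig_transform_derive a b u t : schwartz_real u ->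
  trig_transform a b (derive1 u) t = - t * trig_transform b (- a) u t.
Proof.
move=> hu; have hu' := schwartz_real_derive1 hu.
pose w x := trig a b (t * x) * u x.
pose w' x := 1 * (trig a b (t * x) * derive1 u x) +
  t * (trig b (- a) (t * x) * u x).
have dw (x : R) : is_derive x (1 : R) w (w' x).
  have h1 := is_deriveM (is_derive_cst t x (1 : R)) (@is_derive_id _ _ x (1 : R)).
  have h2 := @is_derive1_comp _ (trig a b) (cst t * id) x _ _
    (trig_is_derive a b (t * x)) h1.
  apply: (is_derive_eq (is_deriveM h2 (schwartz_is_derive x hu))).
  rewrite /w' /trig /GRing.scale /=. ring.
have cw' : continuous w'.
  move=> x; apply: cvgD; (apply: cvgM; first exact: cvg_cst);
    exact: trig_schwartz_continuous.
have dw' : dominated w'.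
  have [C hC] := @trig_schwartz_dominated a b _ t hu'.
  have [D hD] := @trig_schwartz_dominated b (- a) _ t hu.
  exists (C + `|t| * D) => x; rewrite mulrDl (le_trans (ler_normD _ _)) //.
  by rewrite mul1r lerD // normrM -mulrA ler_wpM2l.
have := Rintegral_derive_eq0 dw cw' (trig_schwartz_dominated a b t hu) dw'.
rewrite Rintegral_combl; try exact: trig_schwartz_integrable.
by rewrite mul1r mulNr => /eqP; rewrite addr_eq0 => /eqP.
Qed.

(** Each derivative only multiplies [u] by the variable, so the class of
    transforms of Schwartz functions is stable under derivation. *)
Lemma trig_transform_derive1n n a b u : schwartz_real u ->
  exists c d v, schwartz_real v /\
    derive1n n (trig_transform a b u) = trig_transform c d v.
Proof.
elim: n a b u => [|n IHn] a b u hu; first by exists a, b, u.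
have hxu := schwartz_real_mulx hu.
have [c [d [v [hv e]]]] := IHn b (- a) _ hxu; exists c, d, v; split => //.
rewrite derive1Sn -e; congr derive1n; apply/funext => t.
rewrite derive1E; have h := trig_transform_is_derive a b t hu.
exact: derive_val.
Qed.

(** Dually, multiplying the transform by [t] amounts to differentiating [u].  As
    a transform is bounded by an L1 norm, this is what yields rapid decay. *)
Lemma trig_transform_mulxn k a b u : schwartz_real u ->
  exists c d v, schwartz_real v /\
    forall t, t ^+ k * trig_transform a b u t = trig_transform c d v t.
Proof.
elim: k a b u => [|k IHk] a b u hu.
  by exists a, b, u; split => // t; rewrite expr0 mul1r.
have [c [d [v [hv e]]]] := IHk b (- a) _ (schwartz_real_derive1 hu).
exists c, d, v; split => // t; rewrite -e trig_transform_derive //.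
have := @trig_transform_coef (- a) (- b) 0 0 (-1) 0 u t hu.
rewrite mul0r !mulr0 !addr0 !mulN1r !opprK => <-.
by rewrite exprSr !mulNr !mulrN mulrA.
Qed.

Lemma schwartz_real_trig_transform a b u :
  schwartz_real u -> schwartz_real (trig_transform a b u).
Proof.
move=> hu; split=> [n x|k n].
  have [c [d [v [hv ->]]]] := trig_transform_derive1n n a b hu.
  by have [] := trig_transform_is_derive c d x hv.
have [c [d [v [hv ->]]]] := trig_transform_derive1n n a b hu.
have [c' [d' [v' [hv' e]]]] := trig_transform_mulxn k c d hv.
by eexists => x; rewrite e; apply: trig_transform_le.
Qed.

End TrigTransform.

(** * The Gaussian and its transform *)
Section Gaussian.
Variable R : realType.
Implicit Types (u v w : R -> R) (a b t x : R).
Local Notation mu := (@lebesgue_measure R).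

Definition gauss x : R := expR (- (x ^+ 2 / 2)).

Lemma gauss_is_derive x : is_derive x 1 gauss (- x * gauss x).
Proof.
have h := is_deriveM (@is_derive_id _ _ x (1 : R)) (@is_derive_id _ _ x (1 : R)).
have h2 := @is_derive1_comp _ expR (- (2^-1 *: (id * id))) x _ _
  (is_derive_expR _) (is_deriveN (is_deriveZ 2^-1 h)).
have e : gauss = expR \o (- (2^-1 *: (id * id))).
  by apply/funext => y; rewrite /gauss /= mulrC expr2.
rewrite e; apply: (is_derive_eq h2).
rewrite mulrC; congr (_ * _).
by rewrite /GRing.scale /=; field.
Qed.

(** These products form a class stable under derivation, which therefore
    contains all the derivatives of the Gaussian. *)
Definition poly_gauss (p : {poly R}) x := p.[x] * gauss x.

Lemma poly_gauss_is_derive p x :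
  is_derive x 1 (poly_gauss p) (poly_gauss (p^`() - 'X * p) x).
Proof.
have h := is_deriveM (is_derive_poly p x) (gauss_is_derive x).
apply: (is_derive_eq h); rewrite /poly_gauss !hornerE /GRing.scale /=; ring.
Qed.

Lemma derive1n_poly_gauss n p : exists q, derive1n n (poly_gauss p) = poly_gauss q.
Proof.
elim: n p => [|n IHn] p; first by exists p.
have [q hq] := IHn (p^`() - 'X * p); exists q; rewrite derive1Sn -hq.
congr derive1n; apply/funext => x; rewrite derive1E.
have h := poly_gauss_is_derive p x; exact: derive_val.
Qed.

(** With [y = x^2 / (2 (n+1))] one has [|x| <= (n+1) (1 + y) <= (n+1) exp y];
    the [n]-th power gives the bound since [n y <= x^2 / 2]. *)
Lemma exprn_gauss_le n x : `|x ^+ n * gauss x| <= n.+1%:R ^+ n.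
Proof.
set c : R := n.+1%:R; have c1 : 1 <= c by rewrite ler1n.
pose y := x ^+ 2 / (2 * c).
have y0 : 0 <= y by rewrite divr_ge0 ?sqr_ge0 // mulr_ge0 // (le_trans ler01).
have hx : `|x| <= c * expR y.
  apply: (@le_trans _ _ (c * (1 + y))); last first.
    by rewrite ler_wpM2l ?expR_ge1Dx // (le_trans ler01).
  have -> : c * (1 + y) = c + x ^+ 2 / 2 by rewrite /y; field; lra.
  rewrite -real_normK ?num_real //.
  by have := sqr_ge0 (`|x| - 1); lra.
rewrite normrM normrX /gauss expRN [`|_^-1|]ger0_norm ?invr_ge0 ?expR_ge0 //.
rewrite ler_pdivrMr ?expR_gt0 //.
apply: (@le_trans _ _ ((c * expR y) ^+ n)).
  by rewrite lerXn2r ?nnegrE // (le_trans _ hx).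
rewrite exprMn ler_wpM2l ?exprn_ge0 // ?(le_trans ler01) //.
rewrite -expRM_natl ler_expR.
have -> : x ^+ 2 / 2 = c * y by rewrite /y; field; lra.
by rewrite ler_wpM2r // ler_nat.
Qed.

Lemma poly_gauss_bounded p k : exists C : R, forall x, `|x ^+ k * poly_gauss p x| <= C.
Proof.
elim/poly_ind: p k => [|p c IHp] k.
  by exists 0 => x; rewrite /poly_gauss horner0 mul0r mulr0 normr0.
have [C hC] := IHp k.+1; exists (C + `|c| * k.+1%:R ^+ k) => x.
rewrite /poly_gauss hornerMXaddC.
have -> : x ^+ k * ((p.[x] * x + c) * gauss x) =
    x ^+ k.+1 * (p.[x] * gauss x) + c * (x ^+ k * gauss x).
  by rewrite exprSr; ring.
rewrite (le_trans (ler_normD _ _)) // lerD ?hC //.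
by rewrite normrM ler_wpM2l ?exprn_gauss_le.
Qed.

Lemma schwartz_real_gauss : schwartz_real gauss.
Proof.
have -> : gauss = poly_gauss 1.
  by apply/funext => x; rewrite /poly_gauss hornerC mul1r.
split=> [n x|k n]; have [q ->] := derive1n_poly_gauss n 1.
  by have [] := poly_gauss_is_derive q x.
exact: poly_gauss_bounded.
Qed.

Lemma derive1_gauss : derive1 gauss = (fun x => - x * gauss x).
Proof.
apply/funext => x; rewrite derive1E; have h := gauss_is_derive x.
exact: derive_val.
Qed.

Lemma Rintegral_gauss : \int[mu]_x gauss x = Num.sqrt (2 * pi).
Proof.
have := @integral_normal_pdf R 0 1; rewrite normal_pdfE ?oner_eq0 // => h.
have := @integrable_normal_pdf R 0 1; rewrite normal_pdfE ?oner_eq0 // => ih.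
have c0 : Num.sqrt (2 * pi) != 0 :> R.
  by rewrite gt_eqF // sqrtr_gt0 mulr_gt0 // pi_gt0.
have e x : gauss x = Num.sqrt (2 * pi) * (normal_peak 1 * normal_fun 0 1 x).
  rewrite /gauss /normal_peak /normal_fun subr0 expr1n mul1r mulrA.
  by rewrite -[pi *+ 2]mulr_natl mulfV // mul1r mulNr.
under eq_Rintegral do rewrite e.
by rewrite RintegralZl // /Rintegral h /= mulr1.
Qed.

(** Since [gauss' = - x gauss], the transform solves the same differential
    equation [y' = - t y] as the Gaussian, and is thus its value at 0 times the
    Gaussian. *)
Lemma trig_transform_gauss a b t :
  trig_transform a b gauss t = a * Num.sqrt (2 * pi) * gauss t.
Proof.
have hG := schwartz_real_gauss.
pose z t := trig_transform a b gauss t * expR (t ^+ 2 / 2).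
have xG : (fun x => x * gauss x) = fun x => -1 * derive1 gauss x + 0 * gauss x.
  by apply/funext => x; rewrite derive1_gauss; ring.
have dz (s : R) : is_derive s (1 : R) z 0.
  have h1 := trig_transform_is_derive a b s hG.
  have h2 := is_deriveM (@is_derive_id _ _ s (1 : R)) (@is_derive_id _ _ s (1 : R)).
  have h3 := @is_derive1_comp _ expR (2^-1 *: (id * id)) s _ _
    (is_derive_expR _) (is_deriveZ 2^-1 h2).
  have h4 := is_deriveM h1 h3.
  have e : z = trig_transform a b gauss * (expR \o (2^-1 *: (id * id))).
    by apply/funext => y; rewrite /z expr2 [_ / 2]mulrC.
  rewrite e; apply: (is_derive_eq h4).
  rewrite xG trig_transform_comb //; last exact: schwartz_real_derive1.
  rewrite trig_transform_derive //.
  have := @trig_transform_coef _ (- a) (- b) 0 0 (-1) 0 gauss s hG.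
  rewrite mul0r !mulr0 !addr0 !mulN1r !opprK => <-.
  by rewrite /GRing.scale /=; field.
have z0 : z 0 = a * Num.sqrt (2 * pi).
  rewrite /z expr0n /= mul0r expR0 mulr1 -Rintegral_gauss -RintegralZl //.
    by apply: eq_Rintegral => x _; rewrite /trig mul0r cos0 sin0 mulr0 mulr1 addr0.
  exact: schwartz_integrable.
rewrite -z0 (is_derive_0_is_cst 0 t dz) /z /gauss expRN mulfK //.
by rewrite gt_eqF // expR_gt0.
Qed.

End Gaussian.

(** * Division of a Schwartz function by x - a *)
Section Division.
Variable R : realType.
Implicit Types (u v w : R -> R) (a b t x : R).
Local Notation mu := (@lebesgue_measure R).
Local Notation I01 := (`[0, 1]%classic : set R).

(** For [v = u'] and [n = 0] this is the quotient [(u x - u a) / (x - a)],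
    written as an integral so that it is visibly smooth at [a]; the weight
    [t ^+ n] accumulates under derivation in [x]. *)
Definition segment_mean a n v x := \int[mu]_(t in I01) (t ^+ n * v (a + t * (x - a))).

Lemma segment_mean_continuous a n v x : schwartz_real v ->
  continuous (fun t => t ^+ n * v (a + t * (x - a))).
Proof.
move=> hv t; apply: cvgM; first exact: exprn_continuous.
apply: (@continuous_comp _ _ _ (fun t => a + t * (x - a)) v); last first.
  exact: schwartz_real_continuous.
by apply: cvgD; [exact: cvg_cst|apply: cvgMl; exact: cvg_id].
Qed.

Lemma segment_integrable w : continuous w -> mu.-integrable I01 (EFin \o w).
Proof.
move=> cw; apply: continuous_compact_integrable; first exact: segment_compact.
exact: continuous_subspaceT.
Qed.

Lemma segment_mean_le a n v (C : R) x : schwartz_real v ->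
  (forall y, `|v y| <= C) -> `|segment_mean a n v x| <= C.
Proof.
move=> hv hC; have cv := @segment_mean_continuous a n v x hv.
have iv := segment_integrable cv.
apply: (le_trans (le_normr_Rintegral _ iv)); first exact: measurable_itv.
have cC : continuous (fun _ : R => C) by move=> y; exact: cvg_cst.
apply: (@le_trans _ _ (\int[mu]_(t in I01) C)).
  apply: le_Rintegral => //.
  - exact: integrable_norm.
  - exact: segment_integrable.
  - move=> t; rewrite /= in_itv /= => /andP[t0 t1].
    rewrite normrM normrX ger0_norm // (le_trans _ (hC (a + t * (x - a)))) //.
    by rewrite ler_piMl // exprn_ile1.
rewrite Rintegral_cst //= lebesgue_measure_itv /= lte_fin ltr01 /=.
by rewrite subr0 mulr1.
Qed.

(** Differentiation under the integral sign, where the bound of [derive1 v] is an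
    integrable majorant because the segment has finite length. *)
Lemma segment_mean_is_derive a n v x : schwartz_real v ->
  is_derive x 1 (segment_mean a n v) (segment_mean a n.+1 (derive1 v) x).
Proof.
move=> hv; have hv' := schwartz_real_derive1 hv.
pose f x t := t ^+ n * v (a + t * (x - a)).
have df (s t : R) : is_derive s (1 : R) (f^~ t) (t ^+ n.+1 * derive1 v (a + t * (s - a))).
  have h1 := is_deriveD (is_derive_cst a s (1 : R)) (is_deriveZ t
    (is_deriveB (@is_derive_id _ _ s (1 : R)) (is_derive_cst a s (1 : R)))).
  have h2 := @is_derive1_comp _ v (cst a + t *: (id - cst a)) s _ _
    (schwartz_is_derive (a + t * (s - a)) hv) h1.
  apply: (is_derive_eq (is_deriveZ (t ^+ n) h2)).
  by rewrite /GRing.scale /= exprSr; ring.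
have pE s t : partial1of2 f s t = t ^+ n.+1 * derive1 v (a + t * (s - a)).
  by rewrite partial1of2E; apply: derive_val.
have [C C0 hC] := schwartz_bounded hv'.
have Ix : `]x - 1, x + 1[%classic x by rewrite /= in_itv /= ltrBlDr !ltrDl ltr01.
pose G (t : R) : R := C.
have G0 t : 0 <= G t by [].
have mI := @measurable_itv R `[0, 1]%R.
have iG : mu.-integrable I01 (EFin \o G).
  by apply: segment_integrable => y; exact: cvg_cst.
have if_ (s : R) : `]x - 1, x + 1[%classic s -> mu.-integrable I01 (EFin \o f s).
  by move=> _; apply/segment_integrable/segment_mean_continuous.
have df1 (s t : R) : `]x - 1, x + 1[%classic s -> I01 t -> derivable (f^~ t) s 1.
  by move=> _ _; have [] := df s t.
have Gub (s t : R) : `]x - 1, x + 1[%classic s -> I01 t -> `|partial1of2 f s t| <= G t.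
  move=> _; rewrite /= in_itv /= => /andP[t0 t1].
  rewrite pE normrM normrX ger0_norm // (le_trans _ (hC (a + t * (s - a)))) //.
  by rewrite ler_piMl // exprn_ile1.
have dF := @derivable_under_integral _ _ _ mu f _ mI _ _ _ Ix if_ df1 _ G0 iG Gub.
have := @differentiation_under_integral _ _ _ mu f _ mI _ _ _ Ix if_ df1 _ G0 iG Gub.
rewrite derive1E => e; apply: DeriveDef => //; rewrite [LHS]e.
by apply: eq_Rintegral => t _; rewrite pE.
Qed.

Lemma schwartz_real_derive1n n u : schwartz_real u -> schwartz_real (derive1n n u).
Proof.
by move=> hu; elim: n => [//|n IHn]; rewrite derive1nS; apply: schwartz_real_derive1.
Qed.

Lemma derive1n_segment_mean a n v : schwartz_real v ->
  derive1n n (segment_mean a 0 v) = segment_mean a n (derive1n n v).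
Proof.
move=> hv; elim: n => [//|n IHn]; rewrite derive1nS IHn; apply/funext => x.
have k := segment_mean_is_derive a n x (schwartz_real_derive1n n hv).
by rewrite derive1E derive1nS; exact: derive_val.
Qed.

(** Fundamental theorem of calculus for [t |-> u (a + t (x - a))] on [0, 1]. *)
Lemma segment_mean_derive1 a u x : schwartz_real u ->
  (x - a) * segment_mean a 0 (derive1 u) x = u x - u a.
Proof.
move=> hu; have hu' := schwartz_real_derive1 hu.
have c0 := @segment_mean_continuous a 0 _ x hu'.
rewrite /segment_mean -RintegralZl; [|exact: measurable_itv|exact: segment_integrable].
pose F t := u (a + t * (x - a)).
have dF (t : R) : is_derive t (1 : R) F ((x - a) * (t ^+ 0 * derive1 u (a + t * (x - a)))).
  have h1 := is_deriveD (is_derive_cst a t (1 : R)) (is_deriveM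
    (@is_derive_id _ _ t (1 : R)) (is_derive_cst (x - a) t (1 : R))).
  have h2 := @is_derive1_comp _ u (cst a + id * cst (x - a)) t _ _
    (schwartz_is_derive (a + t * (x - a)) hu) h1.
  by apply: (is_derive_eq h2); rewrite /GRing.scale /= expr0; ring.
have cF : continuous F.
  move=> t; apply/differentiable_continuous/derivable1_diffP.
  by have [] := dF t.
rewrite /Rintegral (@continuous_FTC2 _ _ F 0 1) //=.
- by rewrite /F mul1r mul0r addr0 (addrC a) subrK.
- by apply: continuous_subspaceT => t; apply: cvgM; [exact: cvg_cst|exact: c0].
- split => [t _||].
  + by have [] := dF t.
  + by apply: cvg_at_right_filter; apply: cF.
  + by apply: cvg_at_left_filter; apply: cF.
- by move=> t _; rewrite derive1E; have h := dF t; exact: derive_val.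
Qed.

(** Leibniz rule for the factor [x - a], whose second derivative vanishes. *)
Lemma derive1n_mul_subr a w (w_ : nat -> R -> R) n :
  (forall m (x : R), is_derive x (1 : R) (w_ m) (w_ m.+1 x)) ->
  w_ 0%N = w -> derive1n n (fun x => (x - a) * w x) =
    (fun x => (x - a) * w_ n x + n%:R * w_ n.-1 x).
Proof.
move=> dw <-; elim: n => [|n IHn]; first by apply/funext => x /=; rewrite mul0r addr0.
rewrite derive1nS IHn; apply/funext => x; rewrite derive1E.
have h := is_deriveD (is_deriveM (is_deriveB (@is_derive_id _ _ x (1 : R))
  (is_derive_cst a x (1 : R))) (dw n x)) (is_deriveZ n%:R (dw n.-1 x)).
rewrite (_ : (fun x => _) = (id - cst a) * w_ n + n%:R *: w_ n.-1); last by [].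
have -> := @derive_val _ _ _ _ _ _ _ h.
rewrite -[(id - cst a) x]/(x - a) /GRing.scale /=.
case: n {IHn h} => [|n] /=; first by ring.
by rewrite -[n.+2%:R]natr1; ring.
Qed.

(** The quotient is [segment_mean a 0 u'], which is smooth with bounded
    derivatives.  Decay of [v^(n)] comes from the Leibniz relation
    [(x - a) v^(n) = u^(n) - n v^(n-1)], by induction on [n] and then on the
    power of [x]. *)
Lemma schwartz_division a u : schwartz_real u -> u a = 0 ->
  exists2 v, schwartz_real v & u = fun x => (x - a) * v x.
Proof.
move=> hu ua; have hu' := schwartz_real_derive1 hu.
pose v := segment_mean a 0 (derive1 u).
have uE : u = fun x => (x - a) * v x.
  by apply/funext => x; rewrite segment_mean_derive1 // ua subr0.
exists v => //.
pose v_ n := segment_mean a n (derive1n n.+1 u).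
have vE n : derive1n n v = v_ n.
  by rewrite derive1n_segment_mean // /v_ derive1Sn.
have dv m x : is_derive x 1 (v_ m) (v_ m.+1 x).
  by rewrite /v_ [derive1n m.+2 u]derive1nS; apply/segment_mean_is_derive/schwartz_real_derive1n.
have bv n : exists C : R, forall x, `|v_ n x| <= C.
  have [C C0 hC] := schwartz_bounded (schwartz_real_derive1n n.+1 hu).
  by exists C => x; apply: segment_mean_le => //; apply: schwartz_real_derive1n.
split=> [n x|k n]; rewrite vE; first by have [] := dv n x.
have b0 m : exists C : R, forall x, `|x ^+ 0 * v_ m x| <= C.
  by have [C hC] := bv m; exists C => x; rewrite expr0 mul1r.
elim: n k => [|n IHn] k.
  elim: k => [|k [C hC]]; first exact: b0.
  have [D hD] := hu.2 k 0%N; exists (D + `|a| * C) => x.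
  have -> : x ^+ k.+1 * v_ 0%N x = x ^+ k * u x + a * (x ^+ k * v_ 0%N x).
    by rewrite uE exprSr -vE /=; ring.
  by rewrite (le_trans (ler_normD _ _)) // lerD ?hD // normrM ler_wpM2l.
elim: k => [|k [C hC]]; first exact: b0.
have [D hD] := hu.2 k n.+1; have [E hE] := IHn k.
exists (D + n.+1%:R * E + `|a| * C) => x.
have e : derive1n n.+1 u x = (x - a) * v_ n.+1 x + n.+1%:R * v_ n x.
  by rewrite {1}uE (derive1n_mul_subr a n.+1 dv).
have -> : x ^+ k.+1 * v_ n.+1 x = x ^+ k * derive1n n.+1 u x
    - n.+1%:R * (x ^+ k * v_ n x) + a * (x ^+ k * v_ n.+1 x).
  move: e; move: (v_ n.+1 x) (v_ n x) (derive1n n.+1 u x) => V W U ->.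
  by rewrite exprSr; ring.
rewrite (le_trans (ler_normD _ _)) // lerD //; last by rewrite normrM ler_wpM2l.
rewrite (le_trans (ler_normB _ _)) // lerD ?hD //.
rewrite normrM normr_nat; exact: (ler_wpM2l (ler0n R n.+1) (hE x)).
Qed.

End Division.

(** * The Fourier transform on the Schwartz space *)
Section ComplexFourier.
Variable R : realType.
Implicit Types (f g h : R -> R[i]) (u v w : R -> R) (a b s t x : R).
Local Notation mu := (@lebesgue_measure R).
Local Notation Re := (@complex.Re R).
Local Notation Im := (@complex.Im R).
Local Notation F := (@fourier R).
Local Notation T := (@trig_transform R).
Local Notation kappa := ((Num.sqrt (2 * pi))^-1 : R).

Lemma trig_transformN a b u t : schwartz_real u -> T (- a) (- b) u t = - T a b u t.
Proof.
move=> hu; have := @trig_transform_coef R a b 0 0 (-1) 0 u t hu.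
by rewrite mul0r !mulr0 !addr0 !mulN1r => <-.
Qed.

Lemma derive1_trig_transform a b u :
  schwartz_real u -> derive1 (T a b u) = T b (- a) (fun x => x * u x).
Proof.
move=> hu; apply/funext => t; rewrite derive1E.
have h := trig_transform_is_derive a b t hu; exact: derive_val.
Qed.

(** The real and imaginary parts, as transforms of real functions: this is how
    the real theory is transferred. *)
Lemma fourierE f t : schwartz f -> F f t =
  (kappa * T 1 0 (fun x => Re (f x)) t + kappa * T 0 1 (fun x => Im (f x)) t) +i*
  (kappa * T 1 0 (fun x => Im (f x)) t + kappa * T 0 (-1) (fun x => Re (f x)) t).
Proof.
move=> [rf jf]; rewrite /fourier /cintegral -!mulrDr.
have D (a b c d : R) u v : schwartz_real u -> schwartz_real v ->
  T a b u t + T c d v t =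
  \int[mu]_x (trig a b (t * x) * u x + trig c d (t * x) * v x).
  by move=> hu hv; rewrite RintegralD //; exact: trig_schwartz_integrable.
rewrite !D //.
rewrite (_ : (fun x => Re _) = fun x =>
  trig 1 0 (t * x) * Re (f x) + trig 0 1 (t * x) * Im (f x)); last first.
  apply/funext => x; case: (f x) => p q /=.
  by rewrite cosN sinN /trig; ring.
rewrite (_ : (fun x => Im _) = fun x =>
  trig 1 0 (t * x) * Im (f x) + trig 0 (-1) (t * x) * Re (f x)); last first.
  apply/funext => x; case: (f x) => p q /=.
  by rewrite cosN sinN /trig; ring.
move: (\int[mu]_x _) (\int[mu]_x _) => p q.
by apply/eqP; rewrite eq_complex /= !mul0r subr0 addr0 !eqxx.
Qed.

Lemma schwartz_fourier f : schwartz f -> schwartz (F f).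
Proof.
move=> hf; have [rf jf] := hf.
have hT (a b : R) u : schwartz_real u -> schwartz_real (T a b u).
  exact: schwartz_real_trig_transform.
split.
  rewrite (_ : (fun x => _) = fun t =>
    kappa * T 1 0 (fun x => Re (f x)) t + kappa * T 0 1 (fun x => Im (f x)) t).
    by apply: schwartz_real_comb; apply: hT.
  by apply/funext => t; rewrite fourierE.
rewrite (_ : (fun x => _) = fun t =>
  kappa * T 1 0 (fun x => Im (f x)) t + kappa * T 0 (-1) (fun x => Re (f x)) t).
  by apply: schwartz_real_comb; apply: hT.
by apply/funext => t; rewrite fourierE.
Qed.

Lemma fourier_lin (c : R[i]) f g : schwartz f -> schwartz g ->
  F (c *: f + g) = c *: F f + F g.
Proof.
move=> hf hg; apply/funext => t; have hcg := schwartz_lin c hf hg.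
rewrite -[RHS]/(c * F f t + F g t) !fourierE //.
have [rf jf] := hf; have [rg jg] := hg.
have eR : (fun x => Re ((c *: f + g) x)) = fun x =>
    1 * (Re c * Re (f x) + (- Im c) * Im (f x)) + 1 * Re (g x).
  by apply/funext => x; rewrite Re_lin !mul1r mulNr.
have eI : (fun x => Im ((c *: f + g) x)) = fun x =>
    1 * (Re c * Im (f x) + Im c * Re (f x)) + 1 * Im (g x).
  by apply/funext => x; rewrite Im_lin !mul1r.
rewrite eR eI !trig_transform_comb //; try exact: schwartz_real_comb.
have n1 u : schwartz_real u -> T 0 (-1) u t = - T 0 1 u t.
  by move=> hu; rewrite -{1}oppr0 trig_transformN.
rewrite !n1 //; case: c {hcg eR eI} => p q /=.
by apply/eqP; rewrite eq_complex /=; apply/andP; split; apply/eqP; ring.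
Qed.

Lemma fourier0 : F 0 = 0.
Proof.
have h0 := @schwartz0 R; have := fourier_lin (-1) h0 h0.
by rewrite scaler0 addr0 scaleN1r addNr.
Qed.

Lemma fourierZ (c : R[i]) f : schwartz f -> F (c *: f) = c *: F f.
Proof.
move=> hf; have := fourier_lin c hf (@schwartz0 R).
by rewrite fourier0 !addr0.
Qed.

Definition mulx f : R -> R[i] := fun x => x%:C * f x.

Lemma Re_mulx f : (fun x => Re (mulx f x)) = fun x => x * Re (f x).
Proof. by apply/funext => x; rewrite /mulx; case: (f x) => p q /=; ring. Qed.

Lemma Im_mulx f : (fun x => Im (mulx f x)) = fun x => x * Im (f x).
Proof. by apply/funext => x; rewrite /mulx; case: (f x) => p q /=; ring. Qed.

Lemma schwartz_mulx f : schwartz f -> schwartz (mulx f).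
Proof.
by move=> [rf jf]; split; rewrite ?Re_mulx ?Im_mulx; apply: schwartz_real_mulx.
Qed.

Lemma mulx_lin (c : R[i]) f g : mulx (c *: f + g) = c *: mulx f + mulx g.
Proof.
apply/funext => x; rewrite -[RHS]/(c * (_ * f x) + _ * g x) /mulx.
by rewrite -[(c *: f + g) x]/(c * f x + g x) mulrDr mulrCA.
Qed.

Lemma fourier_cderive f : schwartz f -> F (cderive f) = 'i%C *: mulx (F f).
Proof.
move=> hf; apply/funext => t; have hf' := schwartz_cderive hf.
rewrite -[RHS]/('i%C * (t%:C * F f t)) !fourierE //.
have [rf jf] := hf; rewrite /cderive /= !trig_transform_derive // oppr0.
have n1 u : schwartz_real u -> T (-1) 0 u t = - T 1 0 u t.
  by move=> hu; rewrite -{1}oppr0 trig_transformN.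
have n2 u : schwartz_real u -> T 0 (-1) u t = - T 0 1 u t.
  by move=> hu; rewrite -{1}oppr0 trig_transformN.
rewrite ?n1 ?n2 //.
by apply/eqP; rewrite eq_complex /=; apply/andP; split; apply/eqP; ring.
Qed.

Lemma fourier_mulx f : schwartz f -> F (mulx f) = 'i%C *: cderive (F f).
Proof.
move=> hf; apply/funext => t; have hf' := schwartz_mulx hf.
rewrite -[RHS]/('i%C * cderive (F f) t) /cderive fourierE //.
have [rf jf] := hf.
have hT (a b : R) u : schwartz_real u -> schwartz_real (T a b u).
  exact: schwartz_real_trig_transform.
rewrite (_ : (fun x => Re (F f x)) = fun t =>
  kappa * T 1 0 (fun x => Re (f x)) t + kappa * T 0 1 (fun x => Im (f x)) t);
  last by apply/funext => y; rewrite fourierE.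
rewrite (_ : (fun x => Im (F f x)) = fun t =>
  kappa * T 1 0 (fun x => Im (f x)) t + kappa * T 0 (-1) (fun x => Re (f x)) t);
  last by apply/funext => y; rewrite fourierE.
rewrite !derive1_comb; try exact: hT.
rewrite !derive1_trig_transform // Re_mulx Im_mulx oppr0.
have hr := schwartz_real_mulx rf; have hj := schwartz_real_mulx jf.
have n1 u : schwartz_real u -> T (-1) 0 u t = - T 1 0 u t.
  by move=> hu; rewrite -{1}oppr0 trig_transformN.
have n2 u : schwartz_real u -> T 0 (-1) u t = - T 0 1 u t.
  by move=> hu; rewrite -{1}oppr0 trig_transformN.
rewrite ?n1 ?n2 //.
by apply/eqP; rewrite eq_complex /=; apply/andP; split; apply/eqP; ring.
Qed.

Definition gaussC : R -> R[i] := fun x => (gauss x)%:C.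

Lemma schwartz_gaussC : schwartz gaussC.
Proof.
split; first exact: schwartz_real_gauss.
by have [_] := @schwartz0 R.
Qed.

Lemma fourier_gaussC : F gaussC = gaussC.
Proof.
apply/funext => t; rewrite fourierE; last exact: schwartz_gaussC.
have z (a b : R) : T a b (fun x => Im (gaussC x)) t = 0.
  rewrite /trig_transform /=; under eq_Rintegral do rewrite mulr0.
  by rewrite Rintegral_cst // mul0r.
rewrite !z /gaussC /= !trig_transform_gauss.
have c0 : Num.sqrt (2 * pi) != 0 :> R.
  by rewrite gt_eqF // sqrtr_gt0 mulr_gt0 // pi_gt0.
by apply/eqP; rewrite eq_complex /=; apply/andP; split; apply/eqP; field.
Qed.

(** The real division applied to both components, in the form [f = (x - s) g]
    expanded so that linearity of [fourier] applies to it. *)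
Lemma schwartz_divisionC s f : schwartz f -> f s = 0 ->
  exists2 g, schwartz g & f = - s%:C *: g + mulx g.
Proof.
move=> [rf jf] fs.
have [u hu eu] := @schwartz_division R s _ rf (congr1 Re fs).
have [v hv ev] := @schwartz_division R s _ jf (congr1 Im fs).
exists (fun x => u x +i* v x) => //.
apply/funext => x; rewrite -[RHS]/(- s%:C * (u x +i* v x) + x%:C * (u x +i* v x)).
apply/eqP; rewrite eq_complex; apply/andP; split; apply/eqP.
  by have /(congr1 (@^~ x)) /= -> := eu; ring.
by have /(congr1 (@^~ x)) /= -> := ev; ring.
Qed.

(** [F F x = i F D F = i (i x) F F]. *)
Lemma fourier2_mulx f : schwartz f -> F (F (mulx f)) = - mulx (F (F f)).
Proof.
move=> hf; have hF := schwartz_fourier hf; have hD := schwartz_cderive hF.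
by rewrite fourier_mulx // fourierZ // fourier_cderive // scalerA -expr2 sqr_i scaleN1r.
Qed.

(** Once [f s = 0] is arranged by subtracting a multiple of the Gaussian, write
    [f = (x - s) g]; then [F (F f) = (- x - s) F (F g)], which vanishes at
    [- s]. *)
Lemma fourier_inversion f s : schwartz f -> F (F f) (- s) = f s.
Proof.
move=> hf; have hG := schwartz_gaussC.
pose c := f s / gaussC s.
have G0 : gaussC s != 0.
  by rewrite eq_complex /= eqxx andbT gt_eqF // expR_gt0.
pose g := - c *: gaussC + f.
have hg : schwartz g by apply: schwartz_lin.
have gs : g s = 0.
  by rewrite -[LHS]/(- c * gaussC s + f s) /c mulNr divfK // addNr.
have [h hh gE] := schwartz_divisionC hg gs.
have FFg : F (F g) (- s) = 0.
  have hm := schwartz_mulx hh.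
  rewrite gE fourier_lin // fourier_lin; try exact: schwartz_fourier.
  rewrite fourier2_mulx // -[LHS]/(- s%:C * F (F h) (- s) - (- s)%:C * F (F h) (- s)).
  by rewrite rmorphN subrr.
have -> : f = c *: gaussC + g.
  by rewrite /g addrA -scalerDl subrr scale0r add0r.
rewrite fourier_lin // fourier_lin; try exact: schwartz_fourier.
rewrite !fourier_gaussC -[LHS]/(c * gaussC (- s) + F (F g) (- s)) FFg.
by rewrite -[RHS]/(c * gaussC s + g s) gs /gaussC /gauss sqrrN.
Qed.

End ComplexFourier.

(** * Commutation with the oscillator *)
Section Commutation.
Variable R : realType.
Implicit Types (f g h : R -> R[i]) (u v w : R -> R) (a b s t x : R).
Local Notation mu := (@lebesgue_measure R).
Local Notation Re := (@complex.Re R).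
Local Notation Im := (@complex.Im R).
Local Notation F := (@fourier R).
Local Notation D := (@cderive R).
Local Notation N1 := (@oscillator R).

Lemma cderive0 : D 0 = 0.
Proof.
have h0 := @schwartz0 R; have := cderive_lin (-1) h0 h0.
by rewrite scaler0 addr0 scaleN1r addNr.
Qed.

Lemma cderiveZ (c : R[i]) f : schwartz f -> D (c *: f) = c *: D f.
Proof.
move=> hf; have := cderive_lin c hf (@schwartz0 R).
by rewrite cderive0 !addr0.
Qed.

Lemma cderiveD f g : schwartz f -> schwartz g -> D (f + g) = D f + D g.
Proof. by move=> hf hg; have := cderive_lin 1 hf hg; rewrite !scale1r. Qed.

Lemma cderive_mulx f : schwartz f -> D (mulx f) = mulx (D f) + f.
Proof.
move=> [rf jf]; apply/funext => x.
rewrite -[RHS]/(x%:C * D f x + f x) /cderive Re_mulx Im_mulx.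
have /= -> := derive1n_mulx 1 rf; have /= -> := derive1n_mulx 1 jf.
by case: (f x) => p q; apply/eqP; rewrite eq_complex /=; apply/andP; split; apply/eqP; ring.
Qed.

Lemma oscillatorE f : N1 f = 2^-1 *: (- D (D f) + mulx (mulx f) + f).
Proof.
congr (_ *: (_ + _ + _)); apply/funext => x.
by rewrite /mulx mulrA -rmorphM -expr2.
Qed.

Lemma oscillatorEx f x :
  N1 f x = 2^-1 * (- D (D f) x + x%:C * (x%:C * f x) + f x).
Proof. by rewrite oscillatorE. Qed.

(** The commutator of [N + 1] with [D] is that of [x^2 / 2], namely [- x]. *)
Lemma oscillator_cderive f : schwartz f -> N1 (D f) = -1 *: mulx f + D (N1 f).
Proof.
move=> hf; have hf' := schwartz_cderive hf; have hf'' := schwartz_cderive hf'.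
have hx := schwartz_mulx hf; have hxx := schwartz_mulx hx.
apply/funext => x; rewrite oscillatorEx -[RHS]/(-1 * (x%:C * f x) + D (N1 f) x).
have hs : schwartz (- D (D f) + mulx (mulx f) + f).
  by do 2?apply: schwartzD => //; apply: schwartzN.
rewrite oscillatorE cderiveZ // cderiveD //; last first.
  by apply: schwartzD => //; apply: schwartzN.
rewrite cderiveD //; last exact: schwartzN.
rewrite -[- D (D f)]scaleN1r cderiveZ // !cderive_mulx //.
rewrite -![(_ *: _) x]/(_ * _) -![(_ + _) x]/(_ x + _ x) -![(_ *: _) x]/(_ * _) /mulx. 
rewrite -![(_ + _) x]/(_ x + _ x) /=.
by field.
Qed.

(** The commutator of [N + 1] with [x] is that of [- D^2 / 2], namely [- D]. *)
Lemma oscillator_mulx f : schwartz f -> N1 (mulx f) = -1 *: D f + mulx (N1 f).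
Proof.
move=> hf; have hf' := schwartz_cderive hf; have hx := schwartz_mulx hf.
have hx' := schwartz_mulx hf'.
apply/funext => x.
rewrite oscillatorEx -[RHS]/(-1 * D f x + x%:C * N1 f x) oscillatorEx.
rewrite cderive_mulx // cderiveD // cderive_mulx //.
rewrite -![(_ + _) x]/(_ x + _ x) /mulx.
by field.
Qed.

Lemma fourierD f g : schwartz f -> schwartz g -> F (f + g) = F f + F g.
Proof. by move=> hf hg; have := fourier_lin 1 hf hg; rewrite !scale1r. Qed.

Lemma mulxZ (c : R[i]) f : mulx (c *: f) = c *: mulx f.
Proof. by apply/funext => x; rewrite /mulx -[LHS]/(_ * (_ * _)) mulrCA. Qed.

Lemma fourier_comb3 (c : R[i]) f g h : schwartz f -> schwartz g -> schwartz h ->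
  F (c *: (- f + g + h)) = c *: (- F f + F g + F h).
Proof.
move=> hf hg hh; have hNf := schwartzN hf.
have hs := schwartzD hNf hg.
rewrite (fourierZ _ (schwartzD hs hh)) (fourierD hs hh) (fourierD hNf hg).
by rewrite -(scaleN1r f) (fourierZ _ hf) scaleN1r.
Qed.

(** [F] sends [- D^2] to [x^2] and [x^2] to [- D^2], so it preserves their sum. *)
Lemma fourier_oscillator f : schwartz f -> F (N1 f) = N1 (F f).
Proof.
move=> hf; have hf' := schwartz_cderive hf; have hx := schwartz_mulx hf.
have hDF := schwartz_cderive (schwartz_fourier hf).
have e1 : F (D (D f)) = - mulx (mulx (F f)).
  by rewrite (fourier_cderive hf') (fourier_cderive hf) mulxZ scalerA -expr2 sqr_i scaleN1r.
have e2 : F (mulx (mulx f)) = - D (D (F f)).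
  by rewrite (fourier_mulx hx) (fourier_mulx hf) (cderiveZ _ hDF) scalerA -expr2 sqr_i scaleN1r.
rewrite !oscillatorE (fourier_comb3 _ (schwartz_cderive hf') (schwartz_mulx hx) hf).
by congr (_ *: (_ + _)); rewrite e1 e2 opprK addrC.
Qed.

Lemma iter_fourier_oscillator m f :
  schwartz f -> F (iter m N1 f) = iter m N1 (F f).
Proof.
move=> hf; elim: m => [//|m IHm].
by rewrite !iterS fourier_oscillator ?IHm //; apply: iter_oscillator.
Qed.

End Commutation.

(** * The energy identity *)
Section Energy.
Variable R : realType.
Implicit Types (f g h : R -> R[i]) (u v w : R -> R) (a b s t x : R).
Local Notation mu := (@lebesgue_measure R).
Local Notation Re := (@complex.Re R).
Local Notation Im := (@complex.Im R).
Local Notation F := (@fourier R).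
Local Notation D := (@cderive R).
Local Notation N1 := (@oscillator R).

Definition sqnL2 u := \int[mu]_x (u x ^+ 2).

Lemma schwartzM_dominated u v :
  schwartz_real u -> schwartz_real v -> dominated (fun x => u x * v x).
Proof.
move=> hu hv; have [C _ hC] := schwartz_bounded hu.
exact: dominatedM hC (schwartz_dominated hv).
Qed.

Lemma schwartzM_continuous u v : schwartz_real u -> schwartz_real v ->
  continuous (fun x => u x * v x).
Proof. by move=> hu hv x; apply: cvgM; apply: schwartz_real_continuous. Qed.

Lemma schwartzM_integrable u v : schwartz_real u -> schwartz_real v ->
  mu.-integrable setT (EFin \o (fun x => u x * v x)).
Proof.
move=> hu hv; apply: dominated_integrable; last exact: schwartzM_dominated.
exact: schwartzM_continuous.
Qed.

Lemma Rintegral_mul_derive2 u : schwartz_real u ->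
  \int[mu]_x (u x * derive1 (derive1 u) x) = - sqnL2 (derive1 u).
Proof.
move=> hu; have hu' := schwartz_real_derive1 hu.
have hu'' := schwartz_real_derive1 hu'.
pose w' x := derive1 u x * derive1 u x + u x * derive1 (derive1 u) x.
have dw (x : R) : is_derive x (1 : R) (fun x => u x * derive1 u x) (w' x).
  have h := is_deriveM (schwartz_is_derive x hu) (schwartz_is_derive x hu').
  by apply: (is_derive_eq h); rewrite /w' /GRing.scale /= addrC.
have [C hC] := schwartzM_dominated hu' hu'.
have [E hE] := schwartzM_dominated hu hu''.
have := Rintegral_derive_eq0 dw _ (schwartzM_dominated hu hu') _.
rewrite RintegralD //; try exact: schwartzM_integrable.
move=> e; apply/eqP; rewrite -addr_eq0 addrC; apply/eqP; rewrite -[RHS]e.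
- by [].
- by move=> x; apply: cvgD; exact: schwartzM_continuous.
- by exists (C + E) => x; rewrite (le_trans (ler_normD _ _)) // mulrDl lerD.
Qed.

Definition real_oscillator u x : R :=
  2^-1 * (- derive1 (derive1 u) x + x * (x * u x) + u x).

Lemma schwartz_real_oscillator u : schwartz_real u -> schwartz_real (real_oscillator u).
Proof.
move=> hu; have hx := schwartz_real_mulx (schwartz_real_mulx hu).
have hd := schwartz_real_derive1 (schwartz_real_derive1 hu).
rewrite (_ : real_oscillator u = fun x =>
  2^-1 * (- 1 * derive1 (derive1 u) x + 1 * (x * (x * u x))) + 2^-1 * u x).
  by apply: schwartz_real_comb => //; apply: schwartz_real_comb.
by apply/funext => x; rewrite /real_oscillator; ring.
Qed.

(** Integration by parts turns [- u u''] into [u'^2]. *)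
Lemma energy_identity u : schwartz_real u ->
  sqnL2 (derive1 u) + sqnL2 (fun x => x * u x) + sqnL2 u =
  2 * \int[mu]_x (u x * real_oscillator u x).
Proof.
move=> hu; have hx := schwartz_real_mulx hu.
have hd := schwartz_real_derive1 (schwartz_real_derive1 hu).
have := Rintegral_combl (-1) 1 (schwartzM_integrable hu hd) (schwartzM_integrable hx hx).
rewrite Rintegral_mul_derive2 // mul1r mulN1r opprK => e1.
have i1 := integrable_combl (-1) 1 (schwartzM_integrable hu hd)
  (schwartzM_integrable hx hx).
have := Rintegral_combl 1 1 i1 (schwartzM_integrable hu hu).
rewrite e1 !mul1r => <-.
rewrite -RintegralZl //; last first.
  by apply: schwartzM_integrable => //; apply: schwartz_real_oscillator.
by apply: eq_Rintegral => x _; rewrite /real_oscillator; field.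
Qed.

(** In the energy identity, [2 u (N+1)u <= l u^2 + l^-1 ((N+1)u)^2]; the value
    [l = 1] gives the first two bounds, and [l = 1/2] the last one. *)
Lemma energy_le u : schwartz_real u ->
  [/\ sqnL2 (derive1 u) <= sqnL2 (real_oscillator u),
      sqnL2 (fun x => x * u x) <= sqnL2 (real_oscillator u) &
      sqnL2 u <= 4 * sqnL2 (real_oscillator u)].
Proof.
move=> hu; have ho := schwartz_real_oscillator hu.
have e := energy_identity hu.
have ge0 v : 0 <= sqnL2 v by apply: Rintegral_ge0 => x _; apply: sqr_ge0.
have h0 := ge0 (derive1 u); have h1 := ge0 (fun x => x * u x); have h2 := ge0 u.
have le (l : R) : 0 < l ->
    2 * \int[mu]_x (u x * real_oscillator u x) <=
    l * sqnL2 u + l^-1 * sqnL2 (real_oscillator u).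
  move=> l0; rewrite -RintegralZl //; last exact: schwartzM_integrable.
  have i2 v : schwartz_real v -> mu.-integrable setT (EFin \o (fun x => v x ^+ 2)).
    exact: schwartz_real_sqr_integrable.
  rewrite -Rintegral_combl; try exact: i2.
  apply: le_Rintegral => //.
  - exact/integrable_scale/schwartzM_integrable.
  - by apply: integrable_combl; apply: i2.
  - move=> x _; rewrite -(ler_pM2l l0).
    move: (u x) (real_oscillator u x) => p q.
    have -> : l * (l * p ^+ 2 + l^-1 * q ^+ 2) = l ^+ 2 * p ^+ 2 + q ^+ 2.
      by field; rewrite gt_eqF.
    by have := sqr_ge0 (l * p - q); lra.
have k1 := le 1 ltr01; have k2 := le 2^-1 _.
rewrite invr1 !mul1r in k1; rewrite invrK invr_gt0 ltr0n in k2.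
have {}k2 := k2 isT.
by split; lra.
Qed.

End Energy.

(** * Estimates in the Schwartz norms *)
Section SchwartzNorms.
Variable R : realType.
Implicit Types (f g h : R -> R[i]) (u v w : R -> R) (a b s t x : R).
Local Notation mu := (@lebesgue_measure R).
Local Notation Re := (@complex.Re R).
Local Notation Im := (@complex.Im R).
Local Notation F := (@fourier R).
Local Notation D := (@cderive R).
Local Notation N1 := (@oscillator R).

Lemma sqnL2_ge0 u : 0 <= sqnL2 u.
Proof. by apply: Rintegral_ge0 => x _; apply: sqr_ge0. Qed.

Lemma snorm0_sqr f : schwartz f ->
  snorm 0 f ^+ 2 = sqnL2 (fun x => Re (f x)) + sqnL2 (fun x => Im (f x)).
Proof.
move=> [rf jf]; rewrite /snorm /= sqr_sqrtr; last first.
  by apply: Rintegral_ge0 => x _; apply: sqr_ge0.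
rewrite -RintegralD //; try exact: schwartz_real_sqr_integrable.
by apply: eq_Rintegral => x _; rewrite cabs_sqr.
Qed.

Lemma snormS m f : snorm m.+1 f = snorm m (N1 f).
Proof. by rewrite /snorm iterSr. Qed.

Lemma half_complex : 2^-1 = (2^-1)%:C :> R[i].
Proof. by rewrite fmorphV rmorph_nat. Qed.

Lemma Re_oscillator f : (fun x => Re (N1 f x)) = real_oscillator (fun x => Re (f x)).
Proof.
apply/funext => x; rewrite oscillatorEx /real_oscillator /cderive /= half_complex.
move: (derive1 _ x) (derive1 _ x) => y z.
by case: (f x) => p q /=; ring.
Qed.

Lemma Im_oscillator f : (fun x => Im (N1 f x)) = real_oscillator (fun x => Im (f x)).
Proof.
apply/funext => x; rewrite oscillatorEx /real_oscillator /cderive /= half_complex.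
move: (derive1 _ x) (derive1 _ x) => y z.
by case: (f x) => p q /=; ring.
Qed.

Lemma snorm0_le (C : R) f g : 0 <= C -> snorm 0 f ^+ 2 <= C ^+ 2 * snorm 0 g ^+ 2 ->
  snorm 0 f <= C * snorm 0 g.
Proof.
move=> C0; rewrite -exprMn => h.
by rewrite -(@ler_pXn2r _ 2) // nnegrE ?mulr_ge0 // snorm_ge0.
Qed.

Lemma snorm0_energy f : schwartz f ->
  [/\ snorm 0 (D f) <= snorm 1 f, snorm 0 (mulx f) <= snorm 1 f
    & snorm 0 f <= 2 * snorm 1 f].
Proof.
move=> hf; have hx := schwartz_mulx hf; have hd := schwartz_cderive hf.
have ho := schwartz_oscillator hf; have [rf jf] := hf.
have [a1 a2 a3] := energy_le rf; have [b1 b2 b3] := energy_le jf.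
suff : [/\ snorm 0 (D f) <= 1 * snorm 1 f, snorm 0 (mulx f) <= 1 * snorm 1 f
    & snorm 0 f <= 2 * snorm 1 f] by rewrite !mul1r.
rewrite snormS; split; apply: snorm0_le => //; rewrite !snorm0_sqr // Re_oscillator Im_oscillator.
- by rewrite expr1n mul1r lerD.
- by rewrite expr1n mul1r Re_mulx Im_mulx lerD.
- by rewrite mulrDr -natrX lerD.
Qed.

Lemma snorm_leS m f : schwartz f -> snorm m f <= 2 * snorm m.+1 f.
Proof.
elim: m f => [|m IHm] f hf; first by have [] := snorm0_energy hf.
rewrite (snormS m f) (snormS m.+1 f).
exact: (IHm _ (schwartz_oscillator hf)).
Qed.

Lemma snorm_Ndiff m f g : schwartz f -> schwartz g ->
  snorm m (-1 *: g + f) <= 2 * (snorm m f + snorm m g).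
Proof.
move=> hf hg; rewrite addrC (le_trans (snormD m hf (schwartzZ _ hg))) //.
rewrite snormZ // (_ : cabs (-1) = 1) ?mul1r //.
by rewrite /cabs normrN normr1.
Qed.

(** Order 0 is the energy estimate.  Applying [N + 1] to [D f] or [x f] produces
    [D] or [x] applied to [(N + 1) f] and a commutator of lower order, which
    itself involves the other operator: hence the joint induction. *)
Lemma snorm_cderive_mulx m : exists2 C : R, 0 <= C &
  forall f, schwartz f ->
    snorm m (D f) <= C * snorm m.+1 f /\ snorm m (mulx f) <= C * snorm m.+1 f.
Proof.
elim: m => [|m [C C0 hC]].
  by exists 1 => // f hf; rewrite !mul1r; have [] := snorm0_energy hf.
exists (6 * C) => [|f hf]; first by rewrite mulr_ge0.
have le6 (p q y z : R) : p <= C * z -> q <= C * y -> C * y <= C * (2 * z) ->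
  2 * (p + q) <= 6 * C * z by lra.
have hx := schwartz_mulx hf; have hd := schwartz_cderive hf.
have ho := schwartz_oscillator hf.
have [c1 c2] := hC _ hf; have [d1 d2] := hC _ ho; rewrite -snormS in d1 d2.
have k := ler_wpM2l C0 (snorm_leS m.+1 hf).
split; rewrite (snormS m).
  rewrite (oscillator_cderive hf).
  apply: le_trans (snorm_Ndiff m (schwartz_cderive ho) hx) (le6 _ _ _ _ _ _ k).
    exact: d1.
  exact: c2.
rewrite (oscillator_mulx hf).
apply: le_trans (snorm_Ndiff m (schwartz_mulx ho) hd) (le6 _ _ _ _ _ _ k).
  exact: d2.
exact: c1.
Qed.

(** Cauchy-Schwarz inequality for [u = (1 + x^2)^(-1/2) (1 + x^2)^(1/2) u],
    obtained by integrating
    [2 s |u| <= s^2 (1 + x^2)^-1 + (1 + x^2) u^2] and optimising [s]. *)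
Lemma normL1_sqr_le : exists2 P : R, 0 <= P & forall u, schwartz_real u ->
  normL1 u ^+ 2 <= P * (sqnL2 u + sqnL2 (fun x => x * u x)).
Proof.
have i1 := @integrable_inv_oneDsqr R.
pose P := \int[mu]_x ((1 + x ^+ 2)^-1).
have P0 : 0 <= P.
  by apply: Rintegral_ge0 => x _; rewrite invr_ge0 ltW // oneDsqr_gt0.
exists (P + 1) => [|u hu]; first by rewrite addr_ge0.
have hx := schwartz_real_mulx hu.
set Q := sqnL2 u + _; have Q0 : 0 <= Q by rewrite addr_ge0 ?sqnL2_ge0.
have iu := integrable_norm (schwartz_integrable hu).
have iq : mu.-integrable setT (EFin \o (fun x => 1 * u x ^+ 2 + 1 * (x * u x) ^+ 2)).
  by apply: integrable_combl; apply: schwartz_real_sqr_integrable.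
have QE : Q = \int[mu]_x (1 * u x ^+ 2 + 1 * (x * u x) ^+ 2).
  by rewrite Rintegral_combl ?mul1r //; apply: schwartz_real_sqr_integrable.
have I0 : 0 <= normL1 u by apply: Rintegral_ge0.
have le s : 2 * s * normL1 u <= s ^+ 2 * P + Q.
  rewrite QE -[X in _ + X]mul1r -Rintegral_combl // -RintegralZl //.
  apply: le_Rintegral => //.
  - exact: integrable_scale.
  - exact: integrable_combl.
  - move=> x _; have g0 := oneDsqr_gt0 x.
    rewrite -(ler_pM2l g0).
    have -> : (1 + x ^+ 2) * (s ^+ 2 * (1 + x ^+ 2)^-1
        + 1 * (1 * u x ^+ 2 + 1 * (x * u x) ^+ 2)) =
        s ^+ 2 + ((1 + x ^+ 2) * `|u x|) ^+ 2.
      rewrite [X in _ = _ + X]exprMn real_normK ?num_real //.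
      by field; rewrite gt_eqF.
    have := sqr_ge0 (s - (1 + x ^+ 2) * `|u x|).
    by move: (1 + x ^+ 2) `|u x| => p q; lra.
have P1 : 0 < P + 1 by lra.
(* The minimiser of [s^2 (P + 1) - 2 s I]; replacing [P] by [P + 1] avoids
   showing that [P] is positive. *)
have := le (normL1 u / (P + 1)); set I := normL1 u; set z := P + 1 => h.
have {}h : 2 * (I / z) * I <= (I / z) ^+ 2 * z + Q.
  by apply: (le_trans h); rewrite lerD2r ler_wpM2l ?sqr_ge0 // /z; lra.
rewrite -(ler_pM2l P1) -/z in h.
have e1 : z * (2 * (I / z) * I) = 2 * I ^+ 2 by field; rewrite gt_eqF.
have e2 : z * ((I / z) ^+ 2 * z + Q) = I ^+ 2 + z * Q by field; rewrite gt_eqF.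
rewrite e1 e2 in h; lra.
Qed.

Lemma fourier_sup_le : exists2 K : R, 0 <= K & forall f t, schwartz f ->
  cabs (F f t) ^+ 2 <= K * (snorm 0 f ^+ 2 + snorm 0 (mulx f) ^+ 2).
Proof.
have [P P0 hP] := normL1_sqr_le.
pose k : R := (Num.sqrt (2 * pi))^-1.
have k0 : 0 <= k by rewrite invr_ge0 sqrtr_ge0.
exists (4 * k ^+ 2 * P) => [|f t hf]; first by rewrite !mulr_ge0 ?sqr_ge0.
have hx := schwartz_mulx hf.
rewrite !snorm0_sqr // Re_mulx Im_mulx cabs_sqr fourierE //=; have [rf jf] := hf.
set p := (fun x => Re (f x)); set q := (fun x => Im (f x)).
have hp := hP _ rf; have hq := hP _ jf; rewrite -/p -/q in hp hq.
have b (a b c d : R) u v : `|a| + `|b| = 1 -> `|c| + `|d| = 1 ->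
    schwartz_real u -> schwartz_real v ->
    (k * trig_transform a b u t + k * trig_transform c d v t) ^+ 2 <=
    2 * k ^+ 2 * (normL1 u ^+ 2 + normL1 v ^+ 2).
  move=> e1 e2 hu hv.
  have := trig_transform_le a b t hu; have := trig_transform_le c d t hv.
  rewrite e1 e2 !mul1r.
  move: (trig_transform a b u t) (trig_transform c d v t) (normL1 u) (normL1 v).
  move=> x y X Y hy hx'.
  have hx2 : x ^+ 2 <= X ^+ 2.
    by rewrite -[x ^+ 2]real_normK ?num_real // lerXn2r ?nnegrE ?(le_trans _ hx').
  have hy2 : y ^+ 2 <= Y ^+ 2.
    by rewrite -[y ^+ 2]real_normK ?num_real // lerXn2r ?nnegrE ?(le_trans _ hy).
  have -> : (k * x + k * y) ^+ 2 = k ^+ 2 * (x + y) ^+ 2 by ring.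
  rewrite [2 * _]mulrC -[leRHS]mulrA ler_wpM2l ?sqr_ge0 //.
  by have := sqr_ge0 (x - y); lra.
have b1 : (k * trig_transform 1 0 p t + k * trig_transform 0 1 q t) ^+ 2 <=
    2 * k ^+ 2 * (normL1 p ^+ 2 + normL1 q ^+ 2).
  by apply: b => //; rewrite normr0 normr1 ?addr0 ?add0r.
have b2 : (k * trig_transform 1 0 q t + k * trig_transform 0 (-1) p t) ^+ 2 <=
    2 * k ^+ 2 * (normL1 q ^+ 2 + normL1 p ^+ 2).
  by apply: b => //; rewrite ?normrN normr0 normr1 ?addr0 ?add0r.
rewrite -/k; apply: (le_trans (lerD b1 b2)).
have hs := ler_wpM2l (mulr_ge0 (ler0n _ 4) (sqr_ge0 k)) (lerD hp hq).
apply: le_trans (le_trans hs _); lra.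
Qed.

(** [(1 + t^2) |F f t|^2 = |F f t|^2 + |F (D f) t|^2] is bounded, so [|F f|^2]
    is dominated by a multiple of the integrable function [(1 + t^2)^-1]. *)
Lemma snorm0_fourier_le : exists2 C : R, 0 <= C & forall f, schwartz f ->
  snorm 0 (F f) <= C * snorm 2 f.
Proof.
have [K K0 hK] := fourier_sup_le.
have [A A0 hA] := snorm_cderive_mulx 0; have [B B0 hB] := snorm_cderive_mulx 1.
have i1 := @integrable_inv_oneDsqr R.
pose P := \int[mu]_x ((1 + x ^+ 2)^-1).
have P0 : 0 <= P.
  by apply: Rintegral_ge0 => x _; rewrite invr_ge0 ltW // oneDsqr_gt0.
pose L := K * (16 + 4 * A ^+ 2 + B ^+ 2 * 4 + A ^+ 2 * B ^+ 2).
have L0 : 0 <= L by rewrite !mulr_ge0 // !addr_ge0 ?mulr_ge0 ?sqr_ge0.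
exists (Num.sqrt (L * P)) => [|f hf]; first exact: sqrtr_ge0.
have hx := schwartz_mulx hf; have hd := schwartz_cderive hf.
have hF := schwartz_fourier hf; have hxd := schwartz_mulx hd.
set S := snorm 2 f; have S0 : 0 <= S by exact: snorm_ge0.
have sq (x y : R) : 0 <= x -> x <= y -> x ^+ 2 <= y ^+ 2.
  by move=> x0 xy; rewrite lerXn2r ?nnegrE // (le_trans x0).
have l1 : snorm 1 f <= 2 * S by apply: snorm_leS.
have n0 : snorm 0 f ^+ 2 <= 16 * S ^+ 2.
  have := snorm_leS 0 hf => h.
  have {}h : snorm 0 f <= 4 * S by lra.
  by apply: (le_trans (sq _ _ (snorm_ge0 _ _) h)); rewrite exprMn -natrX.
have n1 : snorm 0 (mulx f) ^+ 2 <= 4 * A ^+ 2 * S ^+ 2.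
  have [_ h] := hA _ hf; have {}h := le_trans h (ler_wpM2l A0 l1).
  apply: (le_trans (sq _ _ (snorm_ge0 _ _) h)); rewrite !exprMn; lra.
have n2 : snorm 0 (D f) ^+ 2 <= 4 * B ^+ 2 * S ^+ 2.
  have h := snorm_leS 0 hd; have [h' _] := hB _ hf; rewrite -/S in h'.
  have {}h : snorm 0 (D f) <= 2 * (B * S) by lra.
  apply: (le_trans (sq _ _ (snorm_ge0 _ _) h)); rewrite !exprMn; lra.
have n3 : snorm 0 (mulx (D f)) ^+ 2 <= A ^+ 2 * B ^+ 2 * S ^+ 2.
  have [_ h] := hA _ hd; have [h' _] := hB _ hf; rewrite -/S in h'.
  have {}h := le_trans h (ler_wpM2l A0 h').
  apply: (le_trans (sq _ _ (snorm_ge0 _ _) h)); rewrite !exprMn; lra.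
have pw t : cabs (F f t) ^+ 2 <= L * S ^+ 2 * (1 + t ^+ 2)^-1.
  rewrite ler_pdivlMr ?oneDsqr_gt0 //.
  have e : cabs (F f t) ^+ 2 * (1 + t ^+ 2) = cabs (F f t) ^+ 2 + cabs (F (D f) t) ^+ 2.
    rewrite fourier_cderive // -[('i%C *: _) t]/('i%C * (t%:C * F f t)) !cabs_sqr.
    by case: (F f t) => p q /=; ring.
  rewrite e; apply: (le_trans (lerD (hK f t hf) (hK _ t hd))).
  rewrite -mulrDr /L -mulrA ler_wpM2l //; lra.
have iF : mu.-integrable setT (EFin \o (fun t => cabs (F f t) ^+ 2)).
  exact: schwartz_sqr_integrable.
rewrite -(@ler_pXn2r _ 2) ?nnegrE ?mulr_ge0 ?sqrtr_ge0 ?snorm_ge0 //.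
have -> : (Num.sqrt (L * P) * S) ^+ 2 = L * S ^+ 2 * P.
  by rewrite exprMn (sqr_sqrtr (mulr_ge0 L0 P0)) mulrAC.
rewrite /snorm /= sqr_sqrtr; last by apply: Rintegral_ge0 => t _; apply: sqr_ge0.
rewrite -RintegralZl //; apply: le_Rintegral => //.
exact: integrable_scale.
Qed.

(** The shift 2 and the constant are the same for all [m], because [F] commutes
    with the powers of the oscillator. *)
Lemma snorm_fourier_le : exists2 C : R, 0 <= C & forall m f, schwartz f ->
  snorm m (F f) <= C * snorm (2 + m) f.
Proof.
have [C C0 hC] := snorm0_fourier_le; exists C => // m f hf.
have -> : snorm m (F f) = snorm 0 (F (iter m N1 f)).
  by rewrite iter_fourier_oscillator.
have -> : snorm (2 + m) f = snorm 2 (iter m N1 f) by rewrite /snorm iterD.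
by apply: hC; apply: iter_oscillator.
Qed.

End SchwartzNorms.

(** * Operators acting termwise on tempered generalized functions *)
Section TermwiseOperators.
Local Open Scope quotient_scope.
Variable R : realType.
Local Notation H := (tempered_gf R).
Local Notation op := ((R -> R[i]) -> (R -> R[i])).
Implicit Types (f g : R -> R[i]) (r s : nat -> R -> R[i]) (Phi Psi : op) (X : H).

(** Continuous linear operators of the Schwartz space.  Values outside that space
    are left free, as for [ifourier]. *)
Definition tempered_operator Phi :=
  [/\ forall f, schwartz f -> schwartz (Phi f),
      forall (c : R[i]) f g, schwartz f -> schwartz g ->
        Phi (c *: f + g) = c *: Phi f + Phi g
    & forall m, exists (C : R) (k : nat), forall f, schwartz f ->
        snorm m (Phi f) <= C * snorm k f].

Lemma tempered_operator_id : tempered_operator id.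
Proof. by split=> // m; exists 1, m => f _; rewrite mul1r. Qed.

Lemma tempered_operator_comp Phi Psi : tempered_operator Phi ->
  tempered_operator Psi -> tempered_operator (Phi \o Psi).
Proof.
move=> [sP lP bP] [sQ lQ bQ]; split=> [f hf|c f g hf hg|m] /=.
- exact/sP/sQ.
- by rewrite lQ // lP //; apply: sQ.
have [C [k hC]] := bP m; have [E [l hE]] := bQ k.
exists (`|C| * E), l => f hf; rewrite -mulrA.
apply: (le_trans (hC _ (sQ _ hf))).
apply: (@le_trans _ _ (`|C| * snorm k (Psi f))).
  by rewrite ler_wpM2r ?snorm_ge0 // ler_norm.
by rewrite ler_wpM2l // hE.
Qed.

Lemma tempered_operator_iter a Phi :
  tempered_operator Phi -> tempered_operator (iter a Phi).
Proof.
move=> hP; elim: a => [|a IHa]; first exact: tempered_operator_id.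
exact: (tempered_operator_comp hP IHa).
Qed.

Lemma tempered_operator_scale (c : R[i]) Phi :
  tempered_operator Phi -> tempered_operator (fun f => c *: Phi f).
Proof.
move=> [sP lP bP]; split=> [f hf|d f g hf hg|m].
- exact/schwartzZ/sP.
- by rewrite lP // scalerDr !scalerA mulrC.
have [C [k hC]] := bP m; exists (cabs c * C), k => f hf.
rewrite snormZ; last exact: sP.
by rewrite -mulrA ler_wpM2l ?cabs_ge0 // hC.
Qed.

Lemma tempered_operator_ext Phi Psi : (forall f, schwartz f -> Phi f = Psi f) ->
  tempered_operator Phi -> tempered_operator Psi.
Proof.
move=> e [sP lP bP]; split=> [f hf|c f g hf hg|m].
- by rewrite -e //; apply: sP.
- by rewrite -!e ?lP //; apply: schwartz_lin.
have [C [k hC]] := bP m; exists C, k => f hf; rewrite -e //; exact: hC.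
Qed.

Lemma moderate_operator Phi r :
  tempered_operator Phi -> moderate r -> moderate (fun n => Phi (r n)).
Proof.
move=> [sP _ bP] [sr mr]; split=> [n|m]; first exact/sP/sr.
have [C [k hC]] := bP m.
apply: (@slowly_increasing_le _ `|C| _ _ _ (mr k) (mr k)) => n.
rewrite !(ger0_norm (snorm_ge0 _ _)) (le_trans (hC _ (sr n))) //.
apply: (@le_trans _ _ (`|C| * snorm k (r n))).
  by rewrite ler_wpM2r ?snorm_ge0 // ler_norm.
by rewrite ler_wpM2l // lerDl snorm_ge0.
Qed.

Lemma negligible_operator Phi r :
  tempered_operator Phi -> Defs.negligible r -> Defs.negligible (fun n => Phi (r n)).
Proof.
move=> [sP _ bP] [sr mr]; split=> [n|m]; first exact/sP/sr.
have [C [k hC]] := bP m.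
apply: (@rapidly_decreasing_le _ `|C| _ _ _ (mr k) (mr k)) => n.
rewrite !(ger0_norm (snorm_ge0 _ _)) (le_trans (hC _ (sr n))) //.
apply: (@le_trans _ _ (`|C| * snorm k (r n))).
  by rewrite ler_wpM2r ?snorm_ge0 // ler_norm.
by rewrite ler_wpM2l // lerDl snorm_ge0.
Qed.

Lemma moderate_insubd r : moderate r ->
  moderate_val (insubd (0 : moderate_seq R) r) = r.
Proof. by move=> hr; apply: insubdK; apply/asboolP. Qed.

(** The difference is written [-1 *: s + r] so that linearity of an operator
    applies to it directly. *)
Lemma gf_class_eq r s : moderate r -> moderate s ->
  gf_class r = gf_class s <-> Defs.negligible (-1 *: s + r).
Proof.
move=> hr hs; rewrite /gf_class.
set x := insubd _ r; set y := insubd _ s.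
have <- : moderate_val (-1 *: y + x) = -1 *: s + r.
  by rewrite moderate_valD moderate_valZ !moderate_insubd.
have -> : -1 *: y + x = x - y by rewrite scaleN1r addrC.
have e : (x - y \in @negligible_pred R) = (\pi_H x == \pi_H y).
  exact: Quotient.idealrBE.
by split=> [/eqP|] h; [apply/asboolP; rewrite -[`[< _ >]]/(x - y \in @negligible_pred R) e|
  apply/eqP; rewrite -e; apply/asboolP].
Qed.

Lemma moderate_repr X : moderate (repr X).
Proof. by case: (repr X) => r /= /asboolP. Qed.

Lemma gf_class_repr X : gf_class (repr X) = X.
Proof. by rewrite /gf_class valKd reprK. Qed.

Lemma gf_class_lin (c : R[i]) r s : moderate r -> moderate s ->
  gf_class (c *: r + s) = c *: gf_class r + gf_class s.
Proof.
move=> hr hs.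
rewrite -[RHS]/(gf_scale c (gf_class r) + gf_class s) /gf_class gf_piZ -gf_piD.
congr (\pi_H _); apply: val_inj.
rewrite -[LHS]/(moderate_val _) -[RHS]/(moderate_val _).
rewrite moderate_valD moderate_valZ !moderate_insubd //.
exact: moderate_lin.
Qed.

Lemma gf_class_scale (c : R[i]) r : moderate r ->
  gf_class (c *: r) = c *: gf_class r.
Proof.
move=> hr; have := gf_class_lin c hr (moderate0 R).
rewrite addr0 => ->; rewrite -[RHS]addr0; congr (_ + _).
have := gf_class_lin (-1) (moderate0 R) (moderate0 R).
by rewrite scaler0 addr0 scaleN1r addNr.
Qed.

(** The chosen representative of the class of [r] differs from [r] by a
    negligible sequence; linearity and the norm bounds make the images differ
    by a negligible sequence too. *)
Lemma tempered_operator_acts Phi : tempered_operator Phi -> acts_termwise Phi.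
Proof.
move=> hP r hr; have hPr := moderate_operator hP hr; split=> //.
set X := gf_class r; have hX := moderate_repr X; have hPX := moderate_operator hP hX.
apply/gf_class_eq => //; have := (gf_class_eq hX hr).1 (gf_class_repr X).
move=> /(negligible_operator hP); congr Defs.negligible.
apply/funext => n; have [_ lP _] := hP.
by rewrite -[_ n]/(-1 *: r n + repr X n) lP //; [apply: hr.1|apply: hX.1].
Qed.

Lemma termwise_class Phi r : tempered_operator Phi -> moderate r ->
  termwise Phi (gf_class r) = gf_class (fun n => Phi (r n)).
Proof. by move=> hP hr; have [] := tempered_operator_acts hP hr. Qed.

Lemma termwise_eq Phi Psi X : (forall f, schwartz f -> Phi f = Psi f) ->
  termwise Phi X = termwise Psi X.
Proof.
move=> e; congr gf_class; apply/funext => n; apply: e.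
exact: (moderate_repr X).1.
Qed.

Lemma termwise_id Phi X : (forall f, schwartz f -> Phi f = f) -> termwise Phi X = X.
Proof. by move=> /termwise_eq ->; apply: gf_class_repr. Qed.

Lemma termwise_comp Phi Psi X : tempered_operator Phi -> tempered_operator Psi ->
  termwise Phi (termwise Psi X) = termwise (Phi \o Psi) X.
Proof.
move=> hP hQ; rewrite termwise_class //.
by apply: moderate_operator => //; apply: moderate_repr.
Qed.

Lemma termwise_iter a Phi X : tempered_operator Phi ->
  iter a (termwise Phi) X = termwise (iter a Phi) X.
Proof.
move=> hP; elim: a => [|a IHa]; first by rewrite termwise_id.
by rewrite iterS IHa termwise_comp //; apply: tempered_operator_iter.
Qed.

Lemma termwise_scale (c : R[i]) Phi X : tempered_operator Phi ->
  c *: termwise Phi X = termwise (fun f => c *: Phi f) X.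
Proof.
move=> hP; rewrite /termwise -gf_class_scale //.
by apply: moderate_operator => //; apply: moderate_repr.
Qed.

Lemma termwise_linear Phi : tempered_operator Phi -> linear (termwise Phi).
Proof.
move=> hP c X Y; have hX := moderate_repr X; have hY := moderate_repr Y.
rewrite -{1}(gf_class_repr X) -{1}(gf_class_repr Y) -gf_class_lin //.
rewrite termwise_class //; last exact: moderate_lin.
rewrite /termwise -gf_class_lin; try exact: moderate_operator.
congr gf_class; apply/funext => n; have [_ lP _] := hP.
exact: (lP c _ _ (hX.1 n) (hY.1 n)).
Qed.

End TermwiseOperators.

(** * Fourier transform, derivation and multiplication as such operators *)
Section FourierOperators.
Variable R : realType.
Implicit Types (f g : R -> R[i]).
Local Notation F := (@fourier R).
Local Notation D := (@cderive R).

Lemma tempered_operator_cderive : tempered_operator D.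
Proof.
split=> [f|c f g|m]; [exact: schwartz_cderive|exact: cderive_lin|].
have [C _ hC] := snorm_cderive_mulx R m; exists C, m.+1 => f hf.
by have [] := hC f hf.
Qed.

Lemma tempered_operator_mulx : tempered_operator (@mulx R).
Proof.
split=> [f|c f g _ _|m]; [exact: schwartz_mulx|exact: mulx_lin|].
have [C _ hC] := snorm_cderive_mulx R m; exists C, m.+1 => f hf.
by have [] := hC f hf.
Qed.

Lemma tempered_operator_fourier : tempered_operator F.
Proof.
split=> [f|c f g|m]; [exact: schwartz_fourier|exact: fourier_lin|].
by have [C _ hC] := snorm_fourier_le R; exists C, (2 + m)%N; apply: hC.
Qed.

Lemma fmul_expx a f : fmul (fun x : R => x%:C ^+ a) f = iter a (@mulx R) f.
Proof.
elim: a => [|a IHa]; first by apply/funext => x; rewrite /fmul expr0 mul1r.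
by rewrite iterS -IHa; apply/funext => x; rewrite /fmul /mulx exprS mulrA.
Qed.

Lemma fmul_expix a f :
  fmul (fun x : R => ('i%C * x%:C) ^+ a) f = 'i%C ^+ a *: iter a (@mulx R) f.
Proof.
rewrite -fmul_expx; apply/funext => x.
by rewrite -[RHS]/(_ * (_ * f x)) /fmul exprMn mulrA.
Qed.

Lemma tempered_operator_expx a : tempered_operator (fmul (fun x : R => x%:C ^+ a)).
Proof.
have -> : fmul (fun x : R => x%:C ^+ a) = iter a (@mulx R).
  by apply/funext => f; rewrite fmul_expx.
exact/tempered_operator_iter/tempered_operator_mulx.
Qed.

Lemma tempered_operator_expix a :
  tempered_operator (fmul (fun x : R => ('i%C * x%:C) ^+ a)).
Proof.
have -> : fmul (fun x : R => ('i%C * x%:C) ^+ a) =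
    fun f => 'i%C ^+ a *: iter a (@mulx R) f.
  by apply/funext => f; rewrite fmul_expix.
exact/tempered_operator_scale/tempered_operator_iter/tempered_operator_mulx.
Qed.

Lemma fourier_iter_cderive a f : schwartz f ->
  F (iter a D f) = fmul (fun x : R => ('i%C * x%:C) ^+ a) (F f).
Proof.
move=> hf; rewrite fmul_expix; have [sD _ _] := tempered_operator_iter a tempered_operator_cderive.
elim: a sD => [|a IHa] sD; first by rewrite expr0 scale1r.
have [sDa _ _] := tempered_operator_iter a tempered_operator_cderive.
rewrite iterS fourier_cderive; last exact: sDa.
by rewrite IHa // mulxZ scalerA -exprS iterS.
Qed.

Lemma fourier_expx a f : schwartz f ->
  F (fmul (fun x : R => x%:C ^+ a) f) = 'i%C ^+ a *: iter a D (F f).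
Proof.
move=> hf; rewrite fmul_expx; elim: a => [|a IHa]; first by rewrite expr0 scale1r.
have [sx _ _] := tempered_operator_iter a tempered_operator_mulx.
have [sDa _ _] := tempered_operator_iter a tempered_operator_cderive.
rewrite iterS fourier_mulx; last exact: sx.
rewrite IHa cderiveZ; last exact/sDa/schwartz_fourier.
by rewrite scalerA -exprS iterS.
Qed.

(** Applying the inversion formula twice reflects twice. *)
Lemma fourier4 f : schwartz f -> F (F (F (F f))) = f.
Proof.
move=> hf; apply/funext => x; rewrite -{1}(opprK x).
rewrite fourier_inversion; last by do 2!apply: schwartz_fourier.
by rewrite fourier_inversion.
Qed.

Lemma fourier_inj : {in (@schwartz R : set (R -> R[i])) &, injective F}.
Proof.
move=> f g /set_mem hf /set_mem hg e.
by rewrite -(fourier4 hf) -(fourier4 hg) e.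
Qed.

Lemma fourier_set_bij : set_bij (@schwartz R) (@schwartz R) F.
Proof.
split; [by move=> f; apply: schwartz_fourier|exact: fourier_inj|].
move=> g hg; exists (F (F (F g))); last exact: fourier4.
by do 3!apply: schwartz_fourier.
Qed.

(** A concrete inverse in place of one obtained by choice; it shows that the
    inverse is again a tempered operator. *)
Lemma ifourierE g : schwartz g -> ifourier g = F (F (F g)).
Proof.
move=> hg; rewrite -{1}(fourier4 hg) /ifourier pinvKV //.
  exact: fourier_inj.
by apply/mem_set; do 3!apply: schwartz_fourier.
Qed.

Lemma tempered_operator_ifourier : tempered_operator (@ifourier R).
Proof.
have hF := tempered_operator_fourier.
apply: (@tempered_operator_ext _ (F \o (F \o F))).
  by move=> f hf; rewrite ifourierE.
by do 2?apply: tempered_operator_comp.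
Qed.

End FourierOperators.

(** * Hermite functions *)
Section HermiteFunctions.
Variable R : realType.
Implicit Types (f g : R -> R[i]) (u v : R -> R) (x : R) (n m : nat).
Local Notation mu := (@lebesgue_measure R).
Local Notation Re := (@complex.Re R).
Local Notation Im := (@complex.Im R).
Local Notation F := (@fourier R).
Local Notation D := (@cderive R).
Local Notation N1 := (@oscillator R).
Local Notation h := (@hermite_fun R).

Definition hermite_real n x : R :=
  Num.sqrt (Num.sqrt 2) * hermite_quarter n (Num.sqrt 2 * x).

Definition hermite_coef n : R :=
  Num.sqrt (Num.sqrt 2) * (Num.sqrt (Num.sqrt (2 * pi) * n`!%:R))^-1 * (-1) ^+ n.

(** The dilation by [sqrt 2] turns [exp (- y^2 / 4) exp (y^2 / 2)] into
    [exp (x^2 / 2)]. *)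
Lemma hermite_realE n x : hermite_real n x =
  hermite_coef n * (expR (2^-1 * (x * x)) * derive1n n (@gauss R) (Num.sqrt 2 * x)).
Proof.
rewrite /hermite_real /hermite_quarter /hermite_poly /hermite_coef.
have -> : expR (2^-1 * (x * x)) =
    expR (- ((Num.sqrt 2 * x) ^+ 2 / 4)) * expR ((Num.sqrt 2 * x) ^+ 2 / 2) :> R.
  by rewrite -expRD; congr expR; rewrite exprMn sqr_sqrtr //; field.
rewrite /gauss; ring.
Qed.

Lemma hermite_coefS n :
  Num.sqrt (2 * n.+1%:R) * hermite_coef n.+1 = - (Num.sqrt 2 * hermite_coef n).
Proof.
rewrite /hermite_coef exprS factS natrM.
rewrite [_ * (_ * n`!%:R)]mulrCA (sqrtrM _ (ler0n R 2)) (sqrtrM _ (ler0n R n.+1)).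
have k0 : Num.sqrt n.+1%:R != 0 :> R by rewrite gt_eqF // sqrtr_gt0.
have A0 : Num.sqrt (Num.sqrt (2 * pi) * n`!%:R) != 0 :> R.
  by rewrite gt_eqF // sqrtr_gt0 mulr_gt0 ?sqrtr_gt0 ?mulr_gt0 ?pi_gt0 // ltr0n fact_gt0.
by field; rewrite k0 A0.
Qed.

Lemma hermite_real_is_derive n x : is_derive x 1 (hermite_real n)
  (x * hermite_real n x - Num.sqrt (2 * n.+1%:R) * hermite_real n.+1 x).
Proof.
have h1 := is_deriveM (@is_derive_id _ _ x (1 : R)) (@is_derive_id _ _ x (1 : R)).
have h2 := @is_derive1_comp _ expR (2^-1 *: (id * id)) x _ _
  (is_derive_expR _) (is_deriveZ 2^-1 h1).
have h3 := is_deriveZ (Num.sqrt 2) (@is_derive_id _ _ x (1 : R)).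
have hG : is_derive (Num.sqrt 2 * x) 1 (derive1n n (@gauss R))
    (derive1n n.+1 (@gauss R) (Num.sqrt 2 * x)).
  by rewrite derive1nS; apply/schwartz_is_derive/schwartz_real_derive1n/schwartz_real_gauss.
have h4 := @is_derive1_comp _ (derive1n n (@gauss R)) (Num.sqrt 2 *: id) x _ _ hG h3.
have h5 := is_deriveZ (hermite_coef n) (is_deriveM h2 h4).
have e : hermite_real n = hermite_coef n *: ((expR \o (2^-1 *: (id * id))) *
    (derive1n n (@gauss R) \o (Num.sqrt 2 *: id))).
  by apply/funext => y; rewrite hermite_realE.
rewrite e; apply: (is_derive_eq h5); rewrite -e !hermite_realE.
rewrite [_ * (hermite_coef n.+1 * _)]mulrA hermite_coefS.
rewrite /GRing.scale /=.
move: (expR _) (derive1n _ _ _) (derive1 _ _) => E a b.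
by field.
Qed.

(** Differentiating the Rodrigues formula: the factor [exp (x^2 / 2)] gives back
    [x h_n], and the derivative of the Gaussian one order up gives [h_(n+1)]. *)
Lemma hermite_real_creation n x :
  Num.sqrt (2 * n.+1%:R) * hermite_real n.+1 x =
  x * hermite_real n x - derive1 (hermite_real n) x.
Proof.
rewrite derive1E; have k := hermite_real_is_derive n x.
by rewrite derive_val; ring.
Qed.

Lemma hermite_real0 x : hermite_real 0 x = hermite_coef 0 * gauss x.
Proof.
rewrite hermite_realE /= /gauss -expRD exprMn sqr_sqrtr //.
by congr (_ * expR _); field.
Qed.

Lemma hermite_realS n : hermite_real n.+1 = fun x =>
  (Num.sqrt (2 * n.+1%:R))^-1 * (x * hermite_real n x) +
  - (Num.sqrt (2 * n.+1%:R))^-1 * derive1 (hermite_real n) x.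
Proof.
by apply/funext => x; rewrite mulNr -mulrBr -hermite_real_creation mulKf //.
Qed.

Lemma schwartz_real_hermite n : schwartz_real (hermite_real n).
Proof.
elim: n => [|n IHn].
  rewrite (_ : hermite_real 0 = fun x => hermite_coef 0 * gauss x + 0 * gauss x).
    by apply: schwartz_real_comb; apply: schwartz_real_gauss.
  by apply/funext => x; rewrite hermite_real0 mul0r addr0.
rewrite hermite_realS; apply: schwartz_real_comb.
  exact: schwartz_real_mulx.
exact: schwartz_real_derive1.
Qed.

Lemma schwartz_hermite n : schwartz (h n).
Proof.
split; first exact: schwartz_real_hermite.
by have [_] := @schwartz0 R.
Qed.

Definition creation f : R -> R[i] := -1 *: D f + mulx f.

Lemma schwartz_creation f : schwartz f -> schwartz (creation f).
Proof.
by move=> hf; apply: schwartz_lin; [exact: schwartz_cderive|exact: schwartz_mulx].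
Qed.

Lemma creationZ (c : R[i]) f : schwartz f -> creation (c *: f) = c *: creation f.
Proof.
by move=> hf; rewrite /creation cderiveZ // mulxZ scalerDr !scalerA mulrC.
Qed.

Lemma hermite_creation n :
  h n.+1 = (Num.sqrt (2 * n.+1%:R))^-1%:C *: creation (h n).
Proof.
apply/funext => x.
rewrite -[RHS]/(_ * (-1 * D (h n) x + x%:C * (hermite_real n x)%:C)).
rewrite -[LHS]/((hermite_real n.+1 x)%:C) hermite_realS /cderive /=.
rewrite -/(hermite_real n) derive1_cst.
by apply/eqP; rewrite eq_complex /=; apply/andP; split; apply/eqP; ring.
Qed.

Lemma oscillatorZ (c : R[i]) f : schwartz f -> N1 (c *: f) = c *: N1 f.
Proof.
move=> hf; have := oscillator_lin c hf (@schwartz0 R).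
have := oscillator_lin (-1) (@schwartz0 R) (@schwartz0 R).
by rewrite scaler0 !addr0 scaleN1r addNr => ->; rewrite addr0.
Qed.

Lemma oscillator_creation f :
  schwartz f -> N1 (creation f) = creation f + creation (N1 f).
Proof.
move=> hf; have hd := schwartz_cderive hf; have hx := schwartz_mulx hf.
rewrite /creation oscillator_lin // (oscillator_cderive hf) (oscillator_mulx hf).
move: (D f) (mulx f) (D (N1 f)) (mulx (N1 f)) => a b c d.
rewrite scalerDr scalerA mulrNN mulr1 scale1r !scaleN1r.
by rewrite [LHS](AC (2*2) ((3*1)*(2*4))).
Qed.

Lemma fourier_creation f : schwartz f -> F (creation f) = - 'i%C *: creation (F f).
Proof.
move=> hf; have hd := schwartz_cderive hf; have hx := schwartz_mulx hf.
rewrite /creation fourier_lin // fourier_cderive // fourier_mulx //.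
by rewrite scalerDr !scalerA mulN1r mulrN1 opprK addrC.
Qed.

(** The Gaussian is the ground state, and the creation operator raises the
    eigenvalue by one. *)
Lemma oscillator_hermite n : N1 (h n) = n.+1%:R *: h n.
Proof.
elim: n => [|n IHn]; last first.
  have hn := schwartz_hermite n; have hc := schwartz_creation hn.
  rewrite hermite_creation oscillatorZ // oscillator_creation // IHn creationZ //.
  rewrite -{1}[creation (h n)]scale1r -scalerDl !scalerA.
  by rewrite nat1r mulrC.
rewrite scale1r; apply/funext => x.
have dg : derive1 (hermite_real 0) = fun x => -1 * (x * hermite_real 0 x) + 0 * hermite_real 0 x.
  apply/funext => y.
  have e : hermite_real 0 = hermite_coef 0 *: (@gauss R).
    by apply/funext => z; rewrite hermite_real0.
  rewrite derive1E {1}e; have k := is_deriveZ (hermite_coef 0) (gauss_is_derive y).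
  by rewrite derive_val hermite_real0 /GRing.scale /=; ring.
have dgg : derive1 (derive1 (hermite_real 0)) x =
    (x ^+ 2 - 1) * hermite_real 0 x.
  have h0 := schwartz_real_hermite 0.
  rewrite {1}dg derive1_comb //; last exact: schwartz_real_mulx.
  have /= -> := derive1n_mulx 1 h0.
  by rewrite dg; ring.
rewrite oscillatorEx /cderive /= -/(hermite_real 0) dgg.
rewrite (_ : (fun y => derive1 _ y) = fun=> 0); last first.
  by apply/funext => y; rewrite derive1_cst.
rewrite derive1_cst half_complex -[hermite_fun 0 x]/((hermite_real 0 x)%:C).
by apply/eqP; rewrite eq_complex /=; apply/andP; split; apply/eqP; field.
Qed.

(** The Gaussian is fixed by [F], and each creation operator contributes a
    factor [- i]. *)
Lemma fourier_hermite n : F (h n) = (- 'i%C) ^+ n *: h n.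
Proof.
elim: n => [|n IHn].
  have -> : h 0 = (hermite_coef 0)%:C *: @gaussC R.
    apply/funext => x; rewrite -[LHS]/((hermite_real 0 x)%:C) hermite_real0.
    by rewrite rmorphM.
  by rewrite fourierZ ?fourier_gaussC ?scale1r //; apply: schwartz_gaussC.
have hn := schwartz_hermite n; have hc := schwartz_creation hn.
rewrite hermite_creation fourierZ // fourier_creation // IHn creationZ //.
by rewrite !scalerA exprS; congr (_ *: _); ring.
Qed.

Lemma real_oscillator_hermite n x :
  real_oscillator (hermite_real n) x = n.+1%:R * hermite_real n x.
Proof.
have := congr1 (fun f => Re (f x)) (oscillator_hermite n).
have := congr1 (@^~ x) (Re_oscillator (h n)) => /= -> ->.
rewrite -[(_ *: h n) x]/(n.+1%:R * (hermite_real n x)%:C).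
by rewrite -(rmorph_nat (real_complex R)) /=; ring.
Qed.

(** The cross term [- 2 x u u'] integrates to the integral of [u^2], since
    [(x u^2)' = u^2 + 2 x u u']. *)
Lemma sqnL2_creation u : schwartz_real u ->
  sqnL2 (fun x => x * u x - derive1 u x) =
  sqnL2 (derive1 u) + sqnL2 (fun x => x * u x) + sqnL2 u.
Proof.
move=> hu; have hx := schwartz_real_mulx hu; have hd := schwartz_real_derive1 hu.
have i1 := schwartzM_integrable hu hu; have i2 := schwartzM_integrable hx hd.
(* The integral of the derivative of [x u^2]. *)
have z : sqnL2 u + 2 * \int[mu]_x (x * u x * derive1 u x) = 0.
  pose w' x := 1 * (u x * u x) + 2 * (x * u x * derive1 u x).
  have dw (x : R) : is_derive x (1 : R) (fun x => x * u x * u x) (w' x).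
    have du := schwartz_is_derive x hu.
    have k := is_deriveM (is_deriveM (@is_derive_id _ _ x (1 : R)) du) du.
    apply: (is_derive_eq k); rewrite -[(id * u) x]/(x * u x) /w' /GRing.scale /=.
    by ring.
  have := Rintegral_derive_eq0 dw _ (schwartzM_dominated hx hu) _.
  rewrite Rintegral_combl // mul1r; apply.
    move=> x; apply: cvgD; (apply: cvgM; first exact: cvg_cst).
      exact: (schwartzM_continuous hu hu).
    exact: (schwartzM_continuous hx hd).
  have [C hC] := schwartzM_dominated hu hu.
  have [E hE] := schwartzM_dominated hx hd.
  exists (C + 2 * E) => x; rewrite (le_trans (ler_normD _ _)) // mul1r [leRHS]mulrDl lerD //.
  by rewrite normrM normr_nat -[leRHS]mulrA ler_wpM2l.
have ix := schwartzM_integrable hx hx; have idd := schwartzM_integrable hd hd.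
have ii := integrable_combl 1 1 idd ix.
have := Rintegral_combl 1 (-2) ii i2; rewrite (Rintegral_combl _ _ idd ix) => e.
rewrite -[RHS]addr0 -{1}[X in _ = X + _]addr0.
have -> : sqnL2 (fun x => x * u x - derive1 u x) =
    \int[mu]_x (1 * (1 * (derive1 u x * derive1 u x) + 1 * (x * u x * (x * u x)))
      + -2 * (x * u x * derive1 u x)).
  by apply: eq_Rintegral => x _; ring.
rewrite e -[X in _ = _ + X + _ + _]/(\int[mu]_x (u x * u x)).
move: z; rewrite /sqnL2 !mul1r; lra.
Qed.

(** The right-hand side of [sqnL2_creation] is twice the energy, which for the
    eigenfunction [h_n] is [2 (n + 1) |h_n|^2]; the normalising factor of
    [h_(n+1)] is exactly the inverse of [sqrt (2 (n + 1))]. *)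
Lemma snorm0_hermite n : snorm 0 (h n) = snorm 0 (h 0).
Proof.
have e m : snorm 0 (h m) ^+ 2 = sqnL2 (hermite_real m).
  rewrite snorm0_sqr; last exact: schwartz_hermite.
  rewrite -[X in sqnL2 X + _]/(hermite_real m) (_ : sqnL2 (fun x => Im (h m x)) = 0) ?addr0 //.
  by rewrite /sqnL2 /= expr0n /= Rintegral_cst // mul0r.
suff s : sqnL2 (hermite_real n) = sqnL2 (hermite_real 0).
  apply/eqP; rewrite -(@eqrXn2 _ 2) ?snorm_ge0 // !e; exact/eqP.
elim: n => [//|n <-]; have hn := schwartz_real_hermite n.
have c0 : 2 * n.+1%:R != 0 :> R by rewrite mulf_neq0 // pnatr_eq0.
apply: (mulfI c0).
have -> : 2 * n.+1%:R * sqnL2 (hermite_real n.+1) =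
    sqnL2 (fun x => x * hermite_real n x - derive1 (hermite_real n) x).
  rewrite /sqnL2 -RintegralZl //; last first.
    exact/schwartz_real_sqr_integrable/schwartz_real_hermite.
  apply: eq_Rintegral => x _; rewrite -hermite_real_creation.
  by move: (hermite_real n.+1 x) => y; rewrite exprMn sqr_sqrtr // mulr_ge0.
rewrite sqnL2_creation // energy_identity // -mulrA; congr (_ * _).
rewrite /sqnL2 -RintegralZl //; last exact: schwartz_real_sqr_integrable.
by apply: eq_Rintegral => x _; rewrite real_oscillator_hermite; ring.
Qed.

Lemma snorm_hermite m n : snorm m (h n) = n.+1%:R ^+ m * snorm 0 (h 0).
Proof.
rewrite -(snorm0_hermite n).
have -> : snorm m (h n) = snorm 0 (iter m N1 (h n)) by [].
have -> : iter m N1 (h n) = n.+1%:R ^+ m *: h n.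
  elim: m => [|m IHm]; first by rewrite scale1r.
  rewrite iterS IHm oscillatorZ ?oscillator_hermite ?scalerA ?exprSr //.
  exact: schwartz_hermite.
rewrite snormZ; last exact: schwartz_hermite.
by congr (_ * _); rewrite /cabs normrX normr_nat -natrX -(rmorph_nat (real_complex R)) natrX.
Qed.

End HermiteFunctions.

(** * Tempered distributions and their Hermite coefficients *)
Section Distributions.
Variable R : realType.
Implicit Types (f g : R -> R[i]) (u v : R -> R) (n m : nat).
Implicit Type T : (R -> R[i]) -> R[i].
Local Notation mu := (@lebesgue_measure R).
Local Notation Re := (@complex.Re R).
Local Notation Im := (@complex.Im R).
Local Notation F := (@fourier R).
Local Notation D := (@cderive R).
Local Notation N1 := (@oscillator R).
Local Notation h := (@hermite_fun R).

Lemma cabsM (a b : R[i]) : cabs (a * b) = cabs a * cabs b.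
Proof. by rewrite /cabs normrM !normc_def -rmorphM. Qed.

(** [2 p q <= s p^2 + s^-1 q^2], integrated. *)
Lemma sqnL2D_le u v (s : R) : 0 < s -> schwartz_real u -> schwartz_real v ->
  sqnL2 (fun x => u x + v x) <= (1 + s) * sqnL2 u + (1 + s^-1) * sqnL2 v.
Proof.
move=> s0 hu hv; have iu := schwartz_real_sqr_integrable hu.
have iv := schwartz_real_sqr_integrable hv.
rewrite -Rintegral_combl //; apply: le_Rintegral => //.
- apply: schwartz_real_sqr_integrable.
  rewrite (_ : (fun x => u x + v x) = fun x => 1 * u x + 1 * v x).
    exact: schwartz_real_comb.
  by apply/funext => x; rewrite !mul1r.
- exact: integrable_combl.
move=> x _; move: (u x) (v x) => p q; rewrite -(ler_pM2l s0).
have -> : s * ((1 + s) * p ^+ 2 + (1 + s^-1) * q ^+ 2) =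
    s * (p ^+ 2 + q ^+ 2) + (s * p) ^+ 2 + q ^+ 2.
  by field; rewrite gt_eqF.
by have := sqr_ge0 (s * p - q); lra.
Qed.

Lemma snormD_sqr_le m f g (s : R) : 0 < s -> schwartz f -> schwartz g ->
  snorm m (f + g) ^+ 2 <= (1 + s) * snorm m f ^+ 2 + (1 + s^-1) * snorm m g ^+ 2.
Proof.
move=> s0 hf hg.
have -> : snorm m (f + g) = snorm 0 (iter m N1 f + iter m N1 g).
  by have := iter_oscillator_lin m 1 hf hg; rewrite !scale1r /snorm => ->.
have -> : snorm m f = snorm 0 (iter m N1 f) by [].
have -> : snorm m g = snorm 0 (iter m N1 g) by [].
have := iter_oscillator m hf; have := iter_oscillator m hg.
move: (iter m N1 f) (iter m N1 g) => {hf hg}a b hb ha.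
rewrite (snorm0_sqr ha) (snorm0_sqr hb) (snorm0_sqr (schwartzD ha hb)).
have [ra ja] := ha; have [rb jb] := hb.
have k1 := sqnL2D_le s0 ra rb; have k2 := sqnL2D_le s0 ja jb.
have e1 : (fun x => Re ((a + b) x)) = fun x => Re (a x) + Re (b x).
  by apply/funext => x; rewrite -[(a + b) x]/(a x + b x); case: (a x) (b x) => ? ? [].
have e2 : (fun x => Im ((a + b) x)) = fun x => Im (a x) + Im (b x).
  by apply/funext => x; rewrite -[(a + b) x]/(a x + b x); case: (a x) (b x) => ? ? [].
rewrite e1 e2; apply: (le_trans (lerD k1 k2)).
by rewrite !mulrDr addrACA.
Qed.

Lemma schwartz_sum (a : nat -> R -> R[i]) n : (forall j, schwartz (a j)) ->
  schwartz (\sum_(j < n) a j).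
Proof.
move=> ha; elim: n => [|n IHn]; first by rewrite big_ord0; apply: schwartz0.
by rewrite big_ord_recr; apply: schwartzD.
Qed.

(** Adding the last of [n + 2] terms with the parameter [s = 1 / (n + 1)] keeps
    the bound linear in the number of terms, whereas iterating [snormD] would
    double it each time. *)
Lemma snorm_sum_le m (a : nat -> R -> R[i]) n (B : R) : 0 <= B ->
  (forall j, schwartz (a j)) -> (forall j, (j < n)%N -> snorm m (a j) <= B) ->
  snorm m (\sum_(j < n) a j) <= n%:R * B.
Proof.
move=> B0 ha; elim: n => [|n IHn] hB; first by rewrite big_ord0 snorm0 mul0r.
have {}IHn := IHn (fun j jn => hB j (ltnW jn)); have hn := hB n (ltnSn n).
case: n IHn hn {hB} => [_ hn|n IHn hn].
  by rewrite big_ord1 mul1r.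
rewrite big_ord_recr /=; set S := \sum_(j < n.+1) a j.
have hS : schwartz S by exact: schwartz_sum.
have s0 : 0 < n.+1%:R^-1 :> R by rewrite invr_gt0.
rewrite -(@ler_pXn2r _ 2) ?nnegrE ?snorm_ge0 ?mulr_ge0 //.
apply: (le_trans (snormD_sqr_le m s0 hS (ha n.+1))).
have k1 : snorm m S ^+ 2 <= (n.+1%:R * B) ^+ 2.
  by rewrite lerXn2r ?nnegrE ?snorm_ge0 ?mulr_ge0.
have k2 : snorm m (a n.+1) ^+ 2 <= B ^+ 2 by rewrite lerXn2r ?nnegrE ?snorm_ge0.
rewrite invrK -[n.+2%:R]nat1r; set N : R := n.+1%:R in s0 k1 *.
have N0 : 0 < N by rewrite ltr0n.
have l1 := ler_wpM2l (addr_ge0 ler01 (ltW s0)) k1.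
have l2 := ler_wpM2l (addr_ge0 ler01 (ltW N0)) k2.
apply: (le_trans (lerD l1 l2)).
by rewrite le_eqVlt; apply/orP; left; apply/eqP; field; rewrite gt_eqF.
Qed.

Section OneDistribution.
Variable T : (R -> R[i]) -> R[i].
Hypothesis hT : tempered_distribution T.

Lemma distribution0 : T 0 = 0.
Proof.
have h0 := @schwartz0 R; have := hT.1 (-1) _ _ h0 h0.
by rewrite scaler0 addr0 mulN1r addNr.
Qed.

Lemma distributionZ (c : R[i]) f : schwartz f -> T (c *: f) = c * T f.
Proof.
move=> hf; have := hT.1 c _ _ hf (@schwartz0 R).
by rewrite distribution0 !addr0.
Qed.

(** Continuity at 0 bounds [T] on a ball of finitely many norms.  All the norms
    of order at most [M] of [h_n] are at most [(n + 1)^M snorm 0 h_0], so a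
    multiple of [h_n] of size about [(n + 1)^(- M)] lies in that ball. *)
Lemma distribution_hermite_le : exists (C : R) (M : nat), 0 <= C /\
  forall n, cabs (T (h n)) <= C * n.+1%:R ^+ M.
Proof.
have [M [d [d0 hd]]] := hT.2 _ (@schwartz0 R) 1 ltr01.
set s := snorm 0 (h 0); have s0 : 0 <= s by exact: snorm_ge0.
exists ((s + 1) / d), M; split=> [|n]; first by rewrite divr_ge0 ?ltW // ltr_wpDl.
have hn := schwartz_hermite R n.
set p : R := n.+1%:R ^+ M; have p1 : 1 <= p by rewrite exprn_ege1 // ler1n.
have s1 : 0 < s + 1 by rewrite ltr_wpDl.
have p0 : 0 < p := lt_le_trans ltr01 p1.
have sp : 0 < (s + 1) * p by exact: mulr_gt0.
(* [s + 1] rather than [s], so that the dilated function lies strictly inside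
   the ball. *)
pose c : R := d / ((s + 1) * p); have c0 : 0 < c by rewrite divr_gt0.
have cc : cabs c%:C = c.
  by rewrite /cabs normc_def /= expr0n addr0 sqrtr_sqr ger0_norm // ltW.
have := hd (c%:C *: h n) (schwartzZ _ hn).
rewrite subr0 distribution0 subr0 distributionZ // cabsM cc => k.
have {}k : c * cabs (T (h n)) < 1.
  apply: k => m mM; rewrite snormZ // cc snorm_hermite -/s.
  apply: (@le_lt_trans _ _ (c * (p * s))).
    by rewrite ler_pM2l // ler_wpM2r // ler_weXn2l // ler1n.
  have -> : d = c * (p * (s + 1)) by rewrite /c; field; rewrite !gt_eqF.
  by rewrite ltr_pM2l // ltr_pM2l // ltrDl.
have -> : (s + 1) / d * p = c^-1 * 1 by rewrite /c; field; rewrite !gt_eqF.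
by rewrite ltW // ltr_pdivlMl.
Qed.

Lemma moderate_hermite_sum : moderate (hermite_sum T).
Proof.
have hh n := schwartz_hermite R n.
have ha j : schwartz (T (h j) *: h j) by exact/schwartzZ/hh.
split=> [n|m]; first exact: (schwartz_sum n.+1 ha).
have [C [M [C0 hC]]] := distribution_hermite_le.
set s := snorm 0 (h 0); have s0 : 0 <= s by exact: snorm_ge0.
exists (C * s), (M + m).+1 => n; rewrite ger0_norm ?snorm_ge0 //.
have B0 : 0 <= C * s * n.+1%:R ^+ (M + m) by rewrite !mulr_ge0 ?exprn_ge0.
rewrite exprS mulrCA; apply: (snorm_sum_le B0 ha) => j jn.
rewrite snormZ // snorm_hermite -/s exprD.
have jn1 : j.+1%:R <= n.+1%:R :> R by rewrite ler_nat.
have pw k : j.+1%:R ^+ k <= n.+1%:R ^+ k :> R by rewrite lerXn2r ?nnegrE.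
have -> : C * s * (n.+1%:R ^+ M * n.+1%:R ^+ m) =
  (C * n.+1%:R ^+ M) * (n.+1%:R ^+ m * s) by ring.
apply: ler_pM; rewrite ?cabs_ge0 ?mulr_ge0 ?exprn_ge0 //.
  by apply: (le_trans (hC j)); rewrite ler_wpM2l.
by rewrite ler_wpM2r.
Qed.

End OneDistribution.

(** Finitely many of the bounds of a tempered operator, merged into one
    neighbourhood of 0. *)
Lemma tempered_operator_small (Phi : (R -> R[i]) -> (R -> R[i])) M (d : R) :
  tempered_operator Phi -> 0 < d -> exists (M' : nat) (d' : R), 0 < d' /\
    forall f, schwartz f -> (forall m, (m <= M')%N -> snorm m f < d') ->
      forall m, (m <= M)%N -> snorm m (Phi f) < d.
Proof.
move=> [_ _ bP] d0.
have one m : exists (k : nat) (e : R), 0 < e /\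
    forall f, schwartz f -> snorm k f < e -> snorm m (Phi f) < d.
  have [C [k hC]] := bP m; have C1 : 0 < `|C| + 1 by rewrite ltr_wpDl.
  exists k, (d / (`|C| + 1)); split=> [|f hf]; first by rewrite divr_gt0.
  rewrite ltr_pdivlMr // => lt; apply: le_lt_trans lt.
  apply: (le_trans (hC f hf)); rewrite mulrC ler_wpM2l ?snorm_ge0 //.
  by rewrite (le_trans (ler_norm C)) // lerDl.
elim: M => [|M [M' [d' [d'0 IH]]]].
  have [k [e [e0 he]]] := one 0%N; exists k, e; split=> // f hf hs m.
  by rewrite leqn0 => /eqP ->; apply: he => //; apply: hs.
have [k [e [e0 he]]] := one M.+1.
exists (maxn M' k), (Num.min d' e); split=> [|f hf hs m].
  by rewrite lt_min d'0.
rewrite leq_eqVlt => /predU1P[->|mM].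
  apply: he => //; have := hs k (leq_maxr _ _).
  by rewrite lt_min => /andP[].
apply: IH => // j jM; have := hs j (leq_trans jM (leq_maxl _ _)).
by rewrite lt_min => /andP[].
Qed.

Lemma tempered_distribution_comp T (Phi : (R -> R[i]) -> (R -> R[i])) :
  tempered_distribution T -> tempered_operator Phi ->
  tempered_distribution (T \o Phi).
Proof.
move=> [lT cT] hP; have [sP lP _] := hP; split=> [c f g hf hg|f hf e e0] /=.
  by rewrite lP // lT //; apply: sP.
have [M [d [d0 hd]]] := cT _ (sP f hf) e e0.
have [M' [d' [d'0 hd']]] := tempered_operator_small M hP d0.
exists M', d'; split=> // g hg hs; apply: hd => [|m mM]; first exact: sP.
have hNf : g - f = -1 *: f + g by rewrite scaleN1r addrC.
have -> : Phi g - Phi f = Phi (g - f) by rewrite hNf lP // scaleN1r addrC.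
by apply: hd' => //; rewrite hNf; apply: schwartz_lin.
Qed.

(** [T (F h_j) = (- i)^j T (h_j)] and [F h_j = (- i)^j h_j]: the same factor
    appears on both sides. *)
Lemma hermite_sum_fourier T : tempered_distribution T ->
  hermite_sum (fourier_dist T) = fun n => F (hermite_sum T n).
Proof.
move=> hT; apply/funext => n; rewrite /hermite_sum.
elim: n.+1 => [|k IHk]; first by rewrite !big_ord0 fourier0.
have hk := schwartz_hermite R k.
have hs j : schwartz (T (h j) *: h j) by exact/schwartzZ/schwartz_hermite.
rewrite !big_ord_recr IHk /= (fourierD (schwartz_sum _ hs) (hs k)).
rewrite (fourierZ _ hk) /fourier_dist fourier_hermite distributionZ //.
by rewrite scalerA [_ * T _]mulrC.
Qed.

End Distributions.

Theorem theorem5p1 (R : realType) :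
  [/\ set_bij (@schwartz R) (@schwartz R) (@fourier R),
      acts_termwise (@fourier R),
      acts_termwise (@ifourier R),
      acts_termwise (@cderive R)
    & forall a : nat,
        acts_termwise (fmul (fun x : R => x%:C ^+ a)) /\
        acts_termwise (fmul (fun x : R => ('i%C * x%:C) ^+ a))] /\
  [/\ linear (@fourier_gf R),
      bijective (@fourier_gf R),
      cancel (@fourier_gf R) (@ifourier_gf R)
    & cancel (@ifourier_gf R) (@fourier_gf R)] /\
  (forall (X : tempered_gf R) (a : nat),
     fourier_gf (iter a (@deriv_gf R) X) =
       mul_gf (fun x : R => ('i%C * x%:C) ^+ a) (fourier_gf X) /\
     fourier_gf (mul_gf (fun x : R => x%:C ^+ a) X) =
       'i%C ^+ a *: iter a (@deriv_gf R) (fourier_gf X)) /\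
  (forall T : (R -> R[i]) -> R[i], tempered_distribution T ->
     [/\ tempered_distribution (fourier_dist T),
         moderate (hermite_sum T),
         moderate (hermite_sum (fourier_dist T))
       & iota_dist (fourier_dist T) = fourier_gf (iota_dist T)]).
Proof.
have hF := tempered_operator_fourier R; have hI := tempered_operator_ifourier R.
have hD := tempered_operator_cderive R.
have sF := @schwartz_fourier R.
have FK : cancel (@fourier_gf R) (@ifourier_gf R).
  move=> X; rewrite /ifourier_gf /fourier_gf termwise_comp // termwise_id // => f hf.
  by rewrite /= ifourierE ?fourier4 //; apply: sF.
have IK : cancel (@ifourier_gf R) (@fourier_gf R).
  move=> X; rewrite /ifourier_gf /fourier_gf termwise_comp // termwise_id // => f hf.
  by rewrite /= ifourierE ?fourier4.
split; [|split; [|split]].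
- split; try exact: tempered_operator_acts; first exact: fourier_set_bij.
  move=> a; split; apply: tempered_operator_acts.
    exact: tempered_operator_expx.
  exact: tempered_operator_expix.
- split=> //; first exact: termwise_linear.
  by exists (@ifourier_gf R).
- move=> X a; have hDa := tempered_operator_iter a hD.
  have hx := tempered_operator_expx R a; have hix := tempered_operator_expix R a.
  rewrite /fourier_gf /deriv_gf /mul_gf !(termwise_iter _ _ hD).
  rewrite (termwise_comp _ hF hDa) (termwise_comp _ hix hF).
  rewrite (termwise_comp _ hF hx) (termwise_comp _ hDa hF).
  split; first by apply: termwise_eq => f hf; apply: fourier_iter_cderive.
  rewrite (termwise_scale _ _ (tempered_operator_comp hDa hF)).
  by apply: termwise_eq => f hf; apply: fourier_expx.
- move=> T hT; have hFT := tempered_distribution_comp hT hF.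
  have hm := moderate_hermite_sum hT.
  split; [exact: hFT|exact: hm|exact: moderate_hermite_sum hFT|].
  rewrite /iota_dist (hermite_sum_fourier hT); symmetry.
  exact: (termwise_class hF hm).
Qed.
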